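(* Let $I\subseteq S=K[x_1,\ldots,x_n]$ be a lexsegment ideal. Then $S/I$ is a pretty clean module.
   Context: $K$ is a field, $S=K[x_1,\ldots,x_n]$ with its standard multigrading (i.e. $\mathbb{Z}^n$-grading), and monomials of $S$ are ordered by the lexicographical order $\geq_{lex}$ induced by $x_1>x_2>\cdots>x_n$. Let $d\geq 2$ be an integer and $\mathcal{M}_d$ the set of monomials of degree $d$ of $S$. For $u,v\in\mathcal{M}_d$ with $u\geq_{lex}v$, the lexsegment set is $L(u,v)=\{w\in\mathcal{M}_d : u\geq_{lex}w\geq_{lex}v\}$. A lexsegment ideal is a monomial ideal $(L(u,v))$ generated by a lexsegment set. Let $M$ be a finitely generated multigraded $S$-module. A multigraded prime filtration of $M$ is a chain of multigraded submodules $0=M_0\subseteq M_1\subseteq\cdots\subseteq M_r=M$ with $M_i/M_{i-1}\cong S/P_i$ (up to a shift of the multigrading), where each $P_i$ is a monomial prime ideal. It is called pretty clean if for all $i<j$, $P_i\subseteq P_j$ implies $P_i=P_j$; in other words, a proper inclusion $P_i\subsetneq P_j$ is possible only if $i>j$. $M$ is called pretty clean if it admits a pretty clean filtration. *)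

(* Defs.v *)
From HB Require Import structures.
From mathcomp Require Import all_boot all_order all_algebra.
From mathcomp Require Import generic_quotient ring_quotient boolp mpoly.

Set Implicit Arguments.
Unset Strict Implicit.
Unset Printing Implicit Defensive.

Import Order.TTheory GRing.Theory.

Local Open Scope ring_scope.
Local Open Scope quotient_scope.

Notation multidegree n := {ffun 'I_n -> int}.

Definition mnm_mdegree n (m : 'X_{1..n}) : multidegree n :=
  [ffun i => (m i)%:Z].

Lemma mnm_mdegree_inj n : injective (@mnm_mdegree n).
Proof.
by move=> m1 m2 /ffunP e; apply/mnmP => i; have := e i; rewrite !ffunE => -[].
Qed.

Lemma mnm_mdegreeD n (m1 m2 : 'X_{1..n}) :
  mnm_mdegree (m1 + m2) = mnm_mdegree m1 + mnm_mdegree m2.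
Proof. by apply/ffunP => i; rewrite !ffunE mnmDE PoszD. Qed.

(* mg_comp a is the homogeneous component of multidegree a.  Closure under    *)
(* scalars of K is mg_compZ at m = 0; mg_span and mg_direct say that the      *)
(* module is the direct sum of its components.                                *)
Record mgModule (K : fieldType) (n : nat) := MgModule {
  mg_sort :> lmodType {mpoly K[n]};
  mg_comp : multidegree n -> mg_sort -> Prop;
  mg_comp0 : forall a, mg_comp a 0;
  mg_compD : forall a x y, mg_comp a x -> mg_comp a y -> mg_comp a (x + y);
  mg_compZ : forall a (m : 'X_{1..n}) (c : K) x,
    mg_comp a x -> mg_comp (mnm_mdegree m + a) ((c *: 'X_[m]) *: x);
  mg_span : forall x, exists (s : seq (multidegree n))
                             (y : multidegree n -> mg_sort),
    [/\ uniq s, forall a, mg_comp a (y a) & x = \sum_(a <- s) y a];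
  mg_direct : forall (s : seq (multidegree n)) (y : multidegree n -> mg_sort),
    uniq s -> (forall a, mg_comp a (y a)) -> \sum_(a <- s) y a = 0 ->
    {in s, forall a, y a = 0} }.

Record mgSubmodule (K : fieldType) (n : nat) (M : mgModule K n) :=
  MgSubmodule {
    mgsub_pred : M -> bool;
    mgsub_closed : submod_closed mgsub_pred;
    mgsub_graded : forall (s : seq (multidegree n)) (y : multidegree n -> M),
      uniq s -> (forall a, mg_comp a (y a)) -> \sum_(a <- s) y a \in mgsub_pred ->
      {in s, forall a, y a \in mgsub_pred} }.

Definition pred_of_mgSubmodule (K : fieldType) (n : nat) (M : mgModule K n)
  (N : mgSubmodule M) : {pred M} := mgsub_pred N.
Coercion pred_of_mgSubmodule : mgSubmodule >-> pred_sort.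

Section Quotient.
Variables (K : fieldType) (n : nat) (M : mgModule K n) (N : mgSubmodule M).

HB.instance Definition _ := GRing.isZmodClosed.Build M (mgsub_pred N)
  (GRing.submod_closedB (mgsub_closed N)).

Definition mgsub_zmod : zmodClosed M :=
  GRing.ZmodClosed.clone _ (mgsub_pred N) _.

Lemma mgsubZ (c : {mpoly K[n]}) (x : M) : x \in N -> c *: x \in N.
Proof.
by move=> Nx; have [N0 NZ] := mgsub_closed N; rewrite -[_ *: _]addr0 NZ.
Qed.

Definition mgquot_sort : Type := Quotient.quot mgsub_zmod.

HB.instance Definition _ := GRing.Zmodule.on mgquot_sort.
HB.instance Definition _ := Quotient.on mgquot_sort.

Definition mgquot_pi (x : M) : mgquot_sort := \pi_mgquot_sort x.

Definition mgquot_scale (c : {mpoly K[n]}) (z : mgquot_sort) : mgquot_sort :=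
  mgquot_pi (c *: repr z).

Lemma mgquot_piP (x y : M) : mgquot_pi x = mgquot_pi y <-> x - y \in N.
Proof.
rewrite /mgquot_pi /mgquot_sort; split=> [e|Nxy].
  by have := Quotient.idealrBE mgsub_zmod x y; rewrite e eqxx.
by apply/eqP; rewrite -(Quotient.idealrBE mgsub_zmod).
Qed.

Lemma mgquot_pi_surj (z : mgquot_sort) : exists x, z = mgquot_pi x.
Proof. by exists (repr z); rewrite /mgquot_pi reprK. Qed.

Lemma mgquot_piD : {morph mgquot_pi : x y / x + y}.
Proof. by move=> x y; rewrite /mgquot_pi /mgquot_sort; rewrite !piE. Qed.

Lemma mgquot_pi0 : mgquot_pi 0 = 0.
Proof. by apply: (addIr (mgquot_pi 0)); rewrite -mgquot_piD !add0r. Qed.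

Lemma mgquot_piZ c x : mgquot_scale c (mgquot_pi x) = mgquot_pi (c *: x).
Proof.
apply/mgquot_piP; rewrite -scalerBr; apply/mgsubZ/mgquot_piP.
by rewrite /mgquot_pi reprK.
Qed.

Fact mgquot_scaleA a b z :
  mgquot_scale a (mgquot_scale b z) = mgquot_scale (a * b) z.
Proof. by have [x ->] := mgquot_pi_surj z; rewrite !mgquot_piZ scalerA. Qed.

Fact mgquot_scale1 : left_id 1 mgquot_scale.
Proof. by move=> z; have [x ->] := mgquot_pi_surj z; rewrite mgquot_piZ scale1r. Qed.

Fact mgquot_scaleDr : right_distributive mgquot_scale +%R.
Proof.
move=> c z t; have [x ->] := mgquot_pi_surj z; have [y ->] := mgquot_pi_surj t.
by rewrite -mgquot_piD !mgquot_piZ scalerDr mgquot_piD.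
Qed.

Fact mgquot_scaleDl z : {morph mgquot_scale^~ z : a b / a + b}.
Proof.
move=> a b; have [x ->] := mgquot_pi_surj z.
by rewrite !mgquot_piZ scalerDl mgquot_piD.
Qed.

HB.instance Definition _ :=
  GRing.Zmodule_isLmodule.Build {mpoly K[n]} mgquot_sort
    mgquot_scaleA mgquot_scale1 mgquot_scaleDr mgquot_scaleDl.

Lemma mgquot_pi_sum (s : seq (multidegree n)) (y : multidegree n -> M) :
  mgquot_pi (\sum_(a <- s) y a) = \sum_(a <- s) mgquot_pi (y a).
Proof. exact: (big_morph _ mgquot_piD mgquot_pi0). Qed.

Definition mgquot_comp (a : multidegree n) (z : mgquot_sort) : Prop :=
  exists2 x, mg_comp a x & z = mgquot_pi x.

Fact mgquot_comp0 a : mgquot_comp a 0.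
Proof. by exists 0; [exact: mg_comp0 | rewrite mgquot_pi0]. Qed.

Fact mgquot_compD a z t :
  mgquot_comp a z -> mgquot_comp a t -> mgquot_comp a (z + t).
Proof.
move=> [x ax ->] [y ay ->]; exists (x + y); first exact: mg_compD.
by rewrite mgquot_piD.
Qed.

Fact mgquot_compZ a (m : 'X_{1..n}) (c : K) z : mgquot_comp a z ->
  mgquot_comp (mnm_mdegree m + a) ((c *: 'X_[m] : {mpoly K[n]}) *: z).
Proof.
move=> [x ax ->]; exists ((c *: 'X_[m] : {mpoly K[n]}) *: x).
  exact: mg_compZ.
exact: mgquot_piZ.
Qed.

Fact mgquot_span (z : mgquot_sort) :
  exists (s : seq (multidegree n)) (y : multidegree n -> mgquot_sort),
    [/\ uniq s, forall a, mgquot_comp a (y a) & z = \sum_(a <- s) y a].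
Proof.
have [x ->] := mgquot_pi_surj z; have [s [y [us hy ->]]] := mg_span x.
exists s, (mgquot_pi \o y); split=> //; last exact: mgquot_pi_sum.
by move=> a; exists (y a).
Qed.

Fact mgquot_direct (s : seq (multidegree n)) (y : multidegree n -> mgquot_sort) :
  uniq s -> (forall a, mgquot_comp a (y a)) -> \sum_(a <- s) y a = 0 ->
  {in s, forall a, y a = 0}.
Proof.
move=> us hy; have /choice[x hx] : forall a, exists u : M,
    mg_comp a u /\ y a = mgquot_pi u by move=> a; have [u] := hy a; exists u.
under eq_bigr do rewrite (hx _).2.
rewrite -mgquot_pi_sum -mgquot_pi0 => /mgquot_piP; rewrite subr0 => Nx a sa.
rewrite (hx a).2; apply/mgquot_piP; rewrite subr0.
exact: (mgsub_graded us (fun b => (hx b).1) Nx sa).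
Qed.

Definition mgquot : mgModule K n :=
  MgModule mgquot_comp0 mgquot_compD mgquot_compZ mgquot_span mgquot_direct.

End Quotient.

Section PolynomialRing.
Variables (K : fieldType) (n : nat).
Implicit Types (a b : multidegree n) (p q : {mpoly K[n]}^o).

Definition mpoly_comp (a : multidegree n) (p : {mpoly K[n]}^o) : Prop :=
  {in msupp (p : {mpoly K[n]}), forall m, mnm_mdegree m = a}.

Lemma mpoly_comp_coef a p m :
  mpoly_comp a p -> mnm_mdegree m != a -> (p : {mpoly K[n]})@_m = 0.
Proof.
move=> ap ma; apply/eqP; apply: contraNT ma; rewrite -mcoeff_msupp => mp.
by rewrite (ap m mp).
Qed.

Lemma mpoly_compP a p :
  (forall m, mnm_mdegree m != a -> (p : {mpoly K[n]})@_m = 0) -> mpoly_comp a p.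
Proof.
move=> h m; rewrite mcoeff_msupp => pm; apply/eqP; apply: contraNT pm => ma.
by rewrite h.
Qed.

Fact mpoly_comp0 a : mpoly_comp a 0.
Proof. by move=> m; rewrite msupp0. Qed.

Fact mpoly_compD a p q : mpoly_comp a p -> mpoly_comp a q -> mpoly_comp a (p + q).
Proof.
move=> ap aq; apply: mpoly_compP => m ma.
by rewrite mcoeffD (mpoly_comp_coef ap ma) (mpoly_comp_coef aq ma) addr0.
Qed.

Fact mpoly_compZ a (m : 'X_{1..n}) (c : K) p : mpoly_comp a p ->
  mpoly_comp (mnm_mdegree m + a) ((c *: 'X_[m] : {mpoly K[n]}) *: p).
Proof.
move=> ap k kin; have : k \in msupp ((p : {mpoly K[n]}) * 'X_[m]).
  have -> : ((p : {mpoly K[n]}) * 'X_[m]) = 'X_[m] * (p : {mpoly K[n]}).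
    exact: mulrC.
  by apply: (@msuppZ_le _ _ c); rewrite scalerAl.
rewrite (perm_mem (msuppMX _ _)) => /mapP[k' k'p ->].
by rewrite mnm_mdegreeD (ap k' k'p).
Qed.

Lemma mpoly_comp_sum s (y : multidegree n -> {mpoly K[n]}^o) :
  uniq s -> (forall a, mpoly_comp a (y a)) -> forall a m, a \in s ->
  mnm_mdegree m = a ->
  (y a : {mpoly K[n]})@_m = (\sum_(b <- s) y b : {mpoly K[n]})@_m.
Proof.
move=> us hy a m sa ma; rewrite (bigD1_seq a) //= mcoeffD raddf_sum /=.
rewrite big1 ?addr0 // => b /negbTE ba.
by apply: (mpoly_comp_coef (hy b)); rewrite ma eq_sym ba.
Qed.

Fact mpoly_comp_span p :
  exists (s : seq (multidegree n)) (y : multidegree n -> {mpoly K[n]}^o),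
    [/\ uniq s, forall a, mpoly_comp a (y a) & p = \sum_(a <- s) y a].
Proof.
pose P : {mpoly K[n]} := p.
exists (map (@mnm_mdegree n) (msupp P)),
  (fun a => \sum_(m <- msupp P | mnm_mdegree m == a) P@_m *: 'X_[m]).
split.
- by rewrite (map_inj_uniq (@mnm_mdegree_inj n)) msupp_uniq.
- move=> a; apply: mpoly_compP => m ma; rewrite raddf_sum /= big1 // => k /eqP ka.
  rewrite mcoeffZ mcoeffX; case: eqP => [km|]; last by rewrite mulr0.
  by move: ma; rewrite -km ka eqxx.
- rewrite big_map [LHS](mpolyE P); apply: eq_big_seq => m mP.
  rewrite big_mkcond (bigD1_seq m) ?msupp_uniq //= eqxx big1 ?addr0 // => k km.
  by rewrite (inj_eq (@mnm_mdegree_inj n)) (negPf km).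
Qed.

Fact mpoly_comp_direct (s : seq (multidegree n))
    (y : multidegree n -> {mpoly K[n]}^o) :
  uniq s -> (forall a, mpoly_comp a (y a)) -> \sum_(a <- s) y a = 0 ->
  {in s, forall a, y a = 0}.
Proof.
move=> us hy y0 a sa; apply/mpolyP => m; rewrite mcoeff0.
have [ma|ma] := eqVneq (mnm_mdegree m) a; last exact: mpoly_comp_coef (hy a) ma.
by rewrite (mpoly_comp_sum us hy sa ma) y0 mcoeff0.
Qed.

Definition mpoly_mgModule : mgModule K n :=
  MgModule mpoly_comp0 mpoly_compD mpoly_compZ mpoly_comp_span mpoly_comp_direct.

Variable A : pred 'X_{1..n}.

Definition in_monomial_ideal (p : {mpoly K[n]}) : Prop :=
  exists s : seq ({mpoly K[n]} * 'X_{1..n}),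
    {in s, forall t, t.2 \in A} /\ p = \sum_(t <- s) t.1 * 'X_[t.2].

Definition monomial_ideal_pred : {pred mpoly_mgModule} :=
  fun p => `[< in_monomial_ideal p >].

Lemma in_monomial_idealP (p : {mpoly K[n]}) :
  in_monomial_ideal p <->
  {in msupp p, forall m, exists2 w, w \in A & (w <= m)%MM}.
Proof.
split=> [[s [sA ->]] m | h].
  rewrite mcoeff_msupp raddf_sum /= => /eqP sn0.
  have [/hasP[t ts wm]|/hasPn nw] := boolP (has (fun t => t.2 <= m)%MM s).
    by exists t.2 => //; exact: sA.
  case: sn0; apply: big1_seq => t /andP[_ ts]; apply: memN_msupp_eq0.
  apply: contra (nw t ts); rewrite (perm_mem (msuppMX _ _)) => /mapP[k _ ->].
  exact: lem_addr.
have /choice[f hf] : forall m, exists w,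
    m \in msupp p -> w \in A /\ (w <= m)%MM.
  move=> m; have [mP|_] := boolP (m \in msupp p); last by exists 0%MM.
  by have [w wA wm] := h m mP; exists w.
exists [seq (p@_m *: 'X_[m - f m], f m) | m <- msupp p]; split.
  by move=> _ /mapP[m mP ->]; case: (hf m mP).
rewrite big_map [LHS]mpolyE; apply: eq_big_seq => m mP /=.
by rewrite -scalerAl -mpolyXD submK // (hf m mP).2.
Qed.

Fact monomial_ideal_closed : submod_closed monomial_ideal_pred.
Proof.
split=> [|c p q /asboolP[s [sA ->]] /asboolP[t [tA ->]]]; apply/asboolP.
  by exists [::]; rewrite big_nil.
exists ([seq (c * u.1, u.2) | u <- s] ++ t); split.
  by move=> u; rewrite mem_cat => /orP[/mapP[w ws ->] /=|]; [apply: sA | apply: tA].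
rewrite big_cat big_map /=; congr (_ + _).
rewrite [LHS](mulr_sumr s xpredT (fun u => u.1 * 'X_[u.2]) c).
by apply: eq_bigr => u _; rewrite mulrA.
Qed.

Fact monomial_ideal_graded (s : seq (multidegree n))
    (y : multidegree n -> mpoly_mgModule) :
  uniq s -> (forall a, mg_comp a (y a)) ->
  \sum_(a <- s) y a \in monomial_ideal_pred ->
  {in s, forall a, y a \in monomial_ideal_pred}.
Proof.
move=> us hy /asboolP/in_monomial_idealP h a sa.
apply/asboolP/in_monomial_idealP => m my; apply: h.
have ma := hy a m my; rewrite mcoeff_msupp.
by rewrite -(mpoly_comp_sum us hy sa ma) -mcoeff_msupp.
Qed.

Definition monomial_ideal : mgSubmodule mpoly_mgModule :=
  MgSubmodule monomial_ideal_closed monomial_ideal_graded.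

End PolynomialRing.

Definition monomial_prime (K : fieldType) (n : nat)
    (P : mgSubmodule (mpoly_mgModule K n)) : Prop :=
  [/\ exists A : pred 'X_{1..n}, P =i monomial_ideal K A,
      (1 : {mpoly K[n]}) \notin P
    & @prime_idealr_closed {mpoly K[n]} P].

(* N'/N is the image of N' in M/N; the multidegree c is the shift.            *)
Definition iso_shifted_quotient (K : fieldType) (n : nat) (M : mgModule K n)
    (N N' : mgSubmodule M) (P : mgSubmodule (mpoly_mgModule K n)) : Prop :=
  exists (c : multidegree n) (f : {linear mgquot P -> mgquot N}),
    [/\ injective f,
        forall z, (exists x, z = f x) <-> (exists2 y, y \in N' & z = mgquot_pi N y)
      & forall a x, mg_comp a x -> mg_comp (a + c) (f x)].

(* Only F 0, ..., F r and P 0, ..., P r.-1 matter; P i is the prime of the    *)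
(* factor F i.+1 / F i.                                                       *)
Definition prime_filtration (K : fieldType) (n : nat) (M : mgModule K n)
    (r : nat) (F : nat -> mgSubmodule M)
    (P : nat -> mgSubmodule (mpoly_mgModule K n)) : Prop :=
  [/\ forall x, x \in F 0%N <-> x = 0,
      forall x, x \in F r
    & forall i, (i < r)%N ->
      [/\ {subset F i <= F i.+1}, monomial_prime (P i)
        & iso_shifted_quotient (F i) (F i.+1) (P i)]].

(* No finite generation hypothesis: a prime filtration forces it.             *)
Definition pretty_clean (K : fieldType) (n : nat) (M : mgModule K n) : Prop :=
  exists (r : nat) (F : nat -> mgSubmodule M)
         (P : nat -> mgSubmodule (mpoly_mgModule K n)),
    prime_filtration r F P /\
    (forall i j, (i < j < r)%N -> {subset P i <= P j} -> P i =i P j).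

(* The lexicographic order on exponent vectors, i.e. x_1 > ... > x_n.  (The   *)
(* order of mpoly on 'X_{1..n} compares total degrees first.)                 *)
Definition lexle n (v u : 'X_{1..n}) : bool :=
  ((multinom_val v : n.-tuplelexi nat) <= (multinom_val u : n.-tuplelexi nat))%O.

Definition lexsegment n (d : nat) (u v : 'X_{1..n}) : pred 'X_{1..n} :=
  [pred w | [&& mdeg w == d, lexle w u & lexle v w]].

Definition lexsegment_ideal (K : fieldType) n (d : nat) (u v : 'X_{1..n}) :
    mgSubmodule (mpoly_mgModule K n) :=
  monomial_ideal K (lexsegment d u v).

(* Main.v *)
Require Import Defs.
From HB Require Import structures.
From mathcomp Require Import all_boot all_order all_algebra.
From mathcomp Require Import generic_quotient ring_quotient boolp mpoly.
From mathcomp Require Import zify.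

Set Implicit Arguments.
Unset Strict Implicit.
Unset Printing Implicit Defensive.

Import Order.TTheory GRing.Theory.

(** The plan is to turn the statement into combinatorics of monomials.  A cone
    w K[Z] is the set of multiples of a monomial w by monomials in a set Z of
    variables.  If the monomials outside I are listed as finitely many disjoint
    cones so that I together with any initial part of the list is closed under
    multiplication, then the initial parts give a filtration of S/I whose
    factors are shifts of S/P, with P generated by the variables outside Z.
    For such primes P_i is contained in P_j exactly when Z_j is contained in
    Z_i, so the filtration is pretty clean when no Z is properly contained in
    an earlier one ([pretty_clean_cone_chain]).  Cones are found in blocks with
    a common Z ([pretty_block]).

    If u = v the ideal is principal.  Otherwise let s be the first index at
    which u and v differ.  Their common part and the power of x_s in v divide
    the whole segment, and multiplying an ideal by a variable x_i only adds the
    prime (x_i) at the end of a filtration ([pretty_shift]).  So v may be taken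
    free of x_1, ..., x_s, and u free of x_1, ..., x_(s-1) and divisible by x_s.

    In x_s-degree 0 the ideal I is then an initial lexsegment ideal I_0 in the
    variables after x_s: a monomial m lies in it when its degree is at least d
    and m >= v.  Let Q be the sum of (x_s) and of the saturation of I_0 with
    respect to the last variable, and let T = I : x_s^oo.  The filtration goes
    from I to the intersection of T and Q, then to Q, then to S.
    - Between I and the intersection of T and Q there are finitely many
      monomials, up to the variables before x_s ([pretty_saturation]).
    - Between that intersection and Q only T matters.  If x_s^2 divides u, or
      u = x_s, then T contains powers of all variables after x_s and one block
      suffices.  Otherwise u = x_s x_q^e ... with e > 0, and T is the sum of
      I_0 and of an ideal F in x_q, ..., x_n, a final lexsegment.  Outside I_0
      one can compare with v up to a first smaller exponent, at some x_j; for
      j < q the variables between x_j and x_q are then free, and F and its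
      saturation with respect to x_q each contribute one block
      ([pretty_middle]).
    - The saturations of I_0 with respect to longer and longer final strings
      of variables give one block each, as for every ideal of Borel type
      ([pretty_tail_faces]).
    The faces Z contain neither x_s nor the last variable in the first part,
    x_s but not the last variable in the second, and the last variable in the
    third.  Hence no bad inclusion can occur between the parts ([pretty_core]). *)

(** * Filtrations by cones of monomials *)

Section Cones.
Variable n : nat.
Implicit Types (I J E : 'X_{1..n} -> Prop) (c : 'X_{1..n} * {set 'I_n}).

Definition upset I := forall m m', (m <= m')%MM -> I m -> I m'.

(** The cone with vertex [c.1] in the directions of the variables of [c.2]. *)
Definition cone c (m : 'X_{1..n}) : Prop :=
  (c.1 <= m)%MM /\ forall i, i \notin c.2 -> m i = c.1 i.

Definition add_cone I c : 'X_{1..n} -> Prop := fun m => I m \/ cone c m.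

(** Disjointness makes the annihilator of the vertex modulo the current stage
    contained in the prime of the face; closure under multiplication gives the
    converse inclusion. *)
Fixpoint cone_chain I (cs : seq ('X_{1..n} * {set 'I_n})) J : Prop :=
  if cs is c :: cs' then
    [/\ forall m, cone c m -> ~ I m, upset (add_cone I c)
      & cone_chain (add_cone I c) cs' J]
  else I = J.

Definition stage I (cs : seq ('X_{1..n} * {set 'I_n})) i :=
  foldl add_cone I (take i cs).

Lemma stageS I cs c0 i : (i < size cs)%N ->
  stage I cs i.+1 = add_cone (stage I cs i) (nth c0 cs i).
Proof.
by move=> ics; rewrite /stage (take_nth c0 ics) -cats1 foldl_cat.
Qed.

Lemma cone_chain_stage cs c0 I J : upset I -> cone_chain I cs J ->
  [/\ forall i, upset (stage I cs i),
      forall i, (i < size cs)%N ->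
        forall m, cone (nth c0 cs i) m -> ~ stage I cs i m
    & stage I cs (size cs) = J].
Proof.
rewrite /stage; elim: cs I => [|c cs ih] I upI /=; first by move=> <-; split.
case=> dis up /(ih _ up)[h1 h2 h3]; split=> //.
  by case.
by case=> [|i] /=; [move=> _ | exact: h2].
Qed.

Lemma stage_ge I cs i m : I m -> stage I cs i m.
Proof.
rewrite /stage; elim: (take i cs) I => //= c s ih I Im.
by apply: ih; left.
Qed.

End Cones.

Section QuotientSubmodule.
Variables (K : fieldType) (n : nat) (M : mgModule K n) (N N' : mgSubmodule M).
Hypothesis subNN' : {subset N <= N'}.
Local Open Scope ring_scope.

Lemma mgsub_scale_add (L : mgSubmodule M) a x y :
  x \in L -> y \in L -> a *: x + y \in L.
Proof. by have [_] := mgsub_closed L; apply. Qed.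

Lemma mgsub0 (L : mgSubmodule M) : 0 \in L.
Proof. by have [] := mgsub_closed L. Qed.

Lemma mgsubD (L : mgSubmodule M) x y : x \in L -> y \in L -> x + y \in L.
Proof. by move=> Lx Ly; rewrite -[x]scale1r mgsub_scale_add. Qed.

Lemma mgsubB (L : mgSubmodule M) x y : x \in L -> y \in L -> x - y \in L.
Proof. by move=> Lx Ly; rewrite addrC -scaleN1r mgsub_scale_add. Qed.

Lemma mgsub_subC (L : mgSubmodule M) x y : x - y \in L -> y - x \in L.
Proof. by move=> Lxy; rewrite -opprB -scaleN1r mgsubZ. Qed.

Lemma mgquot_reprK (L : mgSubmodule M) x : x - repr (mgquot_pi L x) \in L.
Proof. by apply/mgquot_piP; rewrite /mgquot_pi reprK. Qed.

Definition mgquot_sub_pred : {pred mgquot N} := fun z => repr z \in N'.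

Lemma mgquot_sub_piE x : (mgquot_pi N x \in mgquot_sub_pred) = (x \in N').
Proof.
have /subNN' d := mgquot_reprK N x.
rewrite unfold_in; apply/idP/idP => h.
  by have := mgsubD d h; rewrite subrK.
by have := mgsubB h d; rewrite subKr.
Qed.

Fact mgquot_sub_closed : submod_closed mgquot_sub_pred.
Proof.
split=> [|a z t]; first by rewrite -(mgquot_pi0 N) mgquot_sub_piE mgsub0.
have [x ->] := mgquot_pi_surj z; have [y ->] := mgquot_pi_surj t.
rewrite !mgquot_sub_piE => Nx Ny.
have -> : a *: mgquot_pi N x + mgquot_pi N y = mgquot_pi N (a *: x + y).
  by rewrite mgquot_piD -mgquot_piZ.
by rewrite mgquot_sub_piE mgsub_scale_add.
Qed.

Fact mgquot_sub_graded (s : seq (multidegree n)) (y : multidegree n -> mgquot N) :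
  uniq s -> (forall a, mg_comp a (y a)) ->
  \sum_(a <- s) y a \in mgquot_sub_pred ->
  {in s, forall a, y a \in mgquot_sub_pred}.
Proof.
move=> us hy; have /choice[x hx] : forall a, exists u : M,
    mg_comp a u /\ y a = mgquot_pi N u by move=> a; have [u] := hy a; exists u.
under eq_bigr do rewrite (hx _).2.
rewrite -mgquot_pi_sum mgquot_sub_piE => Nx a sa.
rewrite (hx a).2 mgquot_sub_piE.
exact: (mgsub_graded us (fun b => (hx b).1) Nx sa).
Qed.

Definition mgquot_sub : mgSubmodule (mgquot N) :=
  MgSubmodule mgquot_sub_closed mgquot_sub_graded.

Lemma mgquot_subE x : (mgquot_pi N x \in mgquot_sub) = (x \in N').
Proof. exact: mgquot_sub_piE. Qed.

End QuotientSubmodule.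

(** * Monomial submodules and face primes *)

Section MonomialSubmodules.
Variables (K : fieldType) (n : nat).
Local Open Scope ring_scope.
Implicit Types (E : 'X_{1..n} -> Prop) (p q : {mpoly K[n]}) (Z : {set 'I_n}).

Definition monomial_submodule E : mgSubmodule (mpoly_mgModule K n) :=
  monomial_ideal K (fun m => `[< E m >]).

Lemma monomial_submoduleP E p : upset E ->
  (p \in monomial_submodule E) <-> (forall m, m \in msupp p -> E m).
Proof.
move=> upE; split=> [/asboolP/in_monomial_idealP h m /h[w /asboolP Ew wm]|h].
  exact: upE wm Ew.
apply/asboolP/in_monomial_idealP => m /h Em; exists m; first exact/asboolP.
exact: lepm_refl.
Qed.

Lemma sub_monomial_submodule E E' : upset E -> upset E' ->
  (forall m, E m -> E' m) ->
  {subset monomial_submodule E <= monomial_submodule E'}.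
Proof.
move=> uE uE' EE' p /(monomial_submoduleP _ uE) h.
by apply/(monomial_submoduleP _ uE') => m /h/EE'.
Qed.

Definition mpoly_restr (P : pred 'X_{1..n}) p : {mpoly K[n]} :=
  \sum_(m <- msupp p | P m) p@_m *: 'X_[m].

Lemma mcoeff_restr P p k : (mpoly_restr P p)@_k = if P k then p@_k else 0.
Proof.
rewrite raddf_sum /= big_mkcond /=.
under eq_bigr do rewrite mcoeffZ mcoeffX.
have [pk|pk] := boolP (k \in msupp p); last first.
  rewrite (memN_msupp_eq0 pk) if_same big1_seq // => m /= mp.
  by case: eqP mp => [->|]; rewrite ?(negPf pk) ?mulr0 ?if_same.
rewrite (bigD1_seq k) ?msupp_uniq //= eqxx mulr1 big1 ?addr0 // => m /negbTE ->.
by rewrite mulr0 if_same.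
Qed.

(** The part of [p] supported in [P], divided by the monomial [w]. *)
Definition mpoly_restr_div P (w : 'X_{1..n}) p : {mpoly K[n]} :=
  \sum_(m <- msupp p | P m) p@_m *: 'X_[m - w].

Lemma mulX_restr_div (P : pred 'X_{1..n}) w p :
  (forall m, m \in msupp p -> P m -> (w <= m)%MM) ->
  'X_[w] * mpoly_restr_div P w p = mpoly_restr P p.
Proof.
move=> wP; rewrite /mpoly_restr_div /mpoly_restr [LHS]big_distrr /=.
rewrite big_seq_cond [RHS]big_seq_cond; apply: eq_bigr => m /andP[mp Pm].
by rewrite -scalerAr -mpolyXD addmC submK // wP.
Qed.

Lemma msuppXM (w m : 'X_{1..n}) p :
  (m \in msupp ('X_[w] * p)) = (w <= m)%MM && ((m - w)%MM \in msupp p).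
Proof.
rewrite mulrC (perm_mem (msuppMX _ _)); apply/mapP/andP => [[k kp ->]|[wm mp]].
  by rewrite lem_addr addmC addmK.
by exists (m - w)%MM => //; rewrite addmC submK.
Qed.

(** The terms of [p] outside [E] all lie in the cone, so together they are a
    multiple of its vertex; this is surjectivity in the isomorphism below. *)
Lemma add_cone_divide E c p : upset E -> upset (add_cone E c) ->
  p \in monomial_submodule (add_cone E c) ->
  exists q : {mpoly K[n]}, p - 'X_[c.1] * q \in monomial_submodule E.
Proof.
move=> upE upE' /(monomial_submoduleP _ upE') pE'.
exists (mpoly_restr_div (fun m => ~~ `[< E m >]) c.1 p).
rewrite mulX_restr_div => [|m /pE'[Em|[]//]]; last by rewrite asboolT.
apply/(monomial_submoduleP _ upE) => m.
rewrite mcoeff_msupp mcoeffB mcoeff_restr.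
by case: asboolP => //= _; rewrite subrr eqxx.
Qed.

Definition meets_compl Z (m : 'X_{1..n}) : Prop := exists2 i, i \notin Z & (0 < m i)%N.

Lemma upset_meets_compl Z : upset (meets_compl Z).
Proof.
move=> m m' /mnm_lepP mm' [i iZ mi]; exists i => //.
exact: leq_trans mi (mm' i).
Qed.

(** The prime generated by the variables outside [Z]. *)
Definition face_prime Z := monomial_submodule (meets_compl Z).

Lemma face_primeP Z p :
  (p \in face_prime Z) <-> (forall m, m \in msupp p -> meets_compl Z m).
Proof. exact: monomial_submoduleP (@upset_meets_compl Z). Qed.

(** The substitution sending the variables outside [Z] to 0. *)
Definition kill_compl Z p : {mpoly K[n]} :=
  mmap (@mpolyC n K) (fun i => if i \in Z then 'X_i else 0) p.

Lemma kill_complM Z : {morph kill_compl Z : p q / p * q}.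
Proof. by move=> p q; rewrite /kill_compl rmorphM. Qed.

Lemma kill_complE Z p :
  kill_compl Z p = mpoly_restr (fun m => ~~ `[< meets_compl Z m >]) p.
Proof.
rewrite /kill_compl /mmap /mpoly_restr [RHS]big_mkcond /=.
apply: eq_bigr => m _; case: asboolP => [[i iZ mi]|h] /=.
  rewrite /mmap1 (bigD1 i) //= (negPf iZ) expr0n.
  by rewrite (gtn_eqF mi) mul0r mulr0.
rewrite mul_mpolyC; congr (_ *: _); rewrite mpolyXE_id; apply: eq_bigr => i _.
case: ifPn => // iZ; have -> : m i = 0%N.
  by apply/eqP; rewrite -leqn0 leqNgt; apply/negP => mi; apply: h; exists i.
by rewrite !expr0.
Qed.

Lemma kill_compl_eq0 Z p : (p \in face_prime Z) <-> kill_compl Z p = 0.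
Proof.
rewrite kill_complE; split=> [/face_primeP h|/mpolyP h].
  apply/mpolyP => m; rewrite mcoeff_restr mcoeff0; case: asboolP => //= nm.
  by apply: memN_msupp_eq0; apply/negP => /h.
apply/face_primeP => m; have := h m; rewrite mcoeff_restr mcoeff0.
by case: asboolP => //= _ p0; rewrite mcoeff_msupp p0 eqxx.
Qed.

(** Primality holds because the ideal is the kernel of a ring morphism into a
    domain. *)
Lemma face_prime_monomial_prime Z : monomial_prime (face_prime Z).
Proof.
split; first by exists (fun m => `[< meets_compl Z m >]).
  apply/negP => /face_primeP /(_ 0%MM); rewrite msupp1 inE eqxx => /(_ isT)[i _].
  by rewrite mnm0E.
move=> p q /kill_compl_eq0; rewrite kill_complM => /eqP; rewrite mulf_eq0.
by case/orP => /eqP /kill_compl_eq0 ->; rewrite ?orbT.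
Qed.

Lemma sub_face_prime Z Z' :
  {subset face_prime Z <= face_prime Z'} -> Z' \subset Z.
Proof.
move=> sub; apply/subsetP => i; apply: contraTT => iZ.
have /sub/face_primeP : ('X_i : {mpoly K[n]}) \in face_prime Z.
  apply/face_primeP => m; rewrite msuppX inE => /eqP->.
  by exists i => //; rewrite mnm1E eqxx.
move=> /(_ U_(i)%MM); rewrite msuppX inE eqxx => /(_ isT)[j jZ'].
by rewrite mnm1E; case: eqP => // ->.
Qed.

End MonomialSubmodules.

(** * From chains of cones to pretty clean filtrations *)

Section ConeFactor.
Variables (K : fieldType) (n : nat) (N : mgSubmodule (mpoly_mgModule K n)).
Variables (E E' : 'X_{1..n} -> Prop) (c : 'X_{1..n} * {set 'I_n}).
Local Open Scope ring_scope.
Hypotheses (upE : upset E) (upE' : upset E') (defE' : E' = add_cone E c).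
Hypothesis disj : forall m, cone c m -> ~ E m.
Hypotheses (subN : {subset N <= monomial_submodule K E})
  (subN' : {subset N <= monomial_submodule K E'}).

Local Notation w := c.1.
Local Notation P := (face_prime K c.2).
Local Notation F := (mgquot_sub subN).
Local Notation F' := (mgquot_sub subN').

Lemma cone_translate m : cone c (m + w)%MM <-> ~ meets_compl c.2 m.
Proof.
split=> [[_ h] [i iZ]|h].
  by have := h i iZ; rewrite mnmDE => /eqP; rewrite -{2}[w i]add0n eqn_add2r => /eqP->.
split=> [|i iZ]; first exact: lem_addl.
rewrite mnmDE; case: (posnP (m i)) => [->//|mi].
by case: h; exists i.
Qed.

(** If m does not leave the face, w m is in the cone and hence not in [E].  If
    it does, w m is a multiple of the vertex outside the cone, and the only
    place left for it in the next stage is [E]. *)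
Lemma cone_colon (p : {mpoly K[n]}) :
  ('X_[w] * p \in monomial_submodule K E) <-> p \in P.
Proof.
split=> [/(monomial_submoduleP _ upE) h|/face_primeP h].
  apply/face_primeP => m mp; apply: contrapT => nm.
  apply: (disj ((cone_translate m).2 nm)); apply: h.
  by rewrite msuppXM lem_addl addmK.
apply/(monomial_submoduleP _ upE) => m; rewrite msuppXM => /andP[wm /h mm].
have : E' m by apply: upE' wm _; rewrite defE'; right; split=> //; exact: lepm_refl.
rewrite defE' => -[//|cm].
by have := (cone_translate (m - w)).1; rewrite submK // => /(_ cm) [].
Qed.

(** Multiplication by the vertex of the cone, on chosen representatives. *)
Definition cone_map (z : mgquot P) : mgquot F :=
  mgquot_pi F (mgquot_pi N ('X_[w] * (repr z : {mpoly K[n]}))).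

Lemma mgquot2_piP (x y : mpoly_mgModule K n) :
  mgquot_pi F (mgquot_pi N x) = mgquot_pi F (mgquot_pi N y) <->
  x - y \in monomial_submodule K E.
Proof.
rewrite -(mgquot_subE subN); have -> : mgquot_pi N (x - y) = mgquot_pi N x - mgquot_pi N y.
  by apply/eqP; rewrite eq_sym subr_eq -mgquot_piD subrK.
exact: mgquot_piP.
Qed.

Lemma cone_map_pi (p : mpoly_mgModule K n) :
  cone_map (mgquot_pi P p) = mgquot_pi F (mgquot_pi N ('X_[w] * (p : {mpoly K[n]}))).
Proof.
apply/mgquot2_piP; rewrite -[_ - _](mulrBr 'X_[w] (_ : {mpoly K[n]})).
apply/cone_colon; exact: (mgsub_subC (mgquot_reprK P p)).
Qed.

Fact cone_map_linear : linear cone_map.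
Proof.
move=> a z t; have [x ->] := mgquot_pi_surj z; have [y ->] := mgquot_pi_surj t.
have -> : a *: mgquot_pi P x + mgquot_pi P y = mgquot_pi P (a *: x + y).
  by rewrite mgquot_piD -mgquot_piZ.
rewrite !cone_map_pi.
have -> : 'X_[w] * (a *: x + y : {mpoly K[n]}) =
   a *: ('X_[w] * (x : {mpoly K[n]}) : mpoly_mgModule K n) + 'X_[w] * (y : {mpoly K[n]}).
  by rewrite mulrDr; congr (_ + _); rewrite mulrCA.
by rewrite !mgquot_piD -!mgquot_piZ.
Qed.

HB.instance Definition _ :=
  GRing.isLinear.Build {mpoly K[n]} (mgquot P) (mgquot F) _ cone_map
    cone_map_linear.

Lemma iso_cone_factor : iso_shifted_quotient F F' P.
Proof.
exists (mnm_mdegree w), cone_map; split=> [z t|z|a z [x ax ->]].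
- have [x ->] := mgquot_pi_surj z; have [y ->] := mgquot_pi_surj t.
  rewrite /= !cone_map_pi => /mgquot2_piP.
  rewrite -[_ - _](mulrBr 'X_[w] (_ : {mpoly K[n]})) => /cone_colon h.
  exact/mgquot_piP.
- split=> [[t ->]|[y]].
    have [x ->] := mgquot_pi_surj t; rewrite /= cone_map_pi.
    exists (mgquot_pi N ('X_[w] * (x : {mpoly K[n]}))) => //.
    rewrite (mgquot_subE subN').
    apply/(monomial_submoduleP _ upE') => m; rewrite msuppXM => /andP[wm _].
    apply: upE' wm _; rewrite defE'; right; split=> //; exact: lepm_refl.
  have [x ->] := mgquot_pi_surj y; rewrite (mgquot_subE subN') => + ->.
  have upE'' : upset (add_cone E c) by rewrite -defE'.
  rewrite defE' => /(add_cone_divide upE upE'')[q xq].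
  by exists (mgquot_pi P q); rewrite /= cone_map_pi; apply/mgquot2_piP.
- rewrite /= cone_map_pi; exists (mgquot_pi N ('X_[w] * (x : {mpoly K[n]}))) => //.
  exists ('X_[w] * (x : {mpoly K[n]})) => //.
  by rewrite addrC -[in 'X_[w]](scale1r 'X_[w]); exact: mpoly_compZ.
Qed.

End ConeFactor.

(** Inclusion of the primes is reverse inclusion of the faces, whence the
    direction of the test. *)
Definition pretty_cones n (cs : seq ('X_{1..n} * {set 'I_n})) : bool :=
  pairwise (fun Z Z' : {set 'I_n} => (Z' \subset Z) ==> (Z' == Z)) [seq c.2 | c <- cs].

(** The bridge to algebra: only monomials remain to be studied. *)
Lemma pretty_clean_cone_chain (K : fieldType) n (A : pred 'X_{1..n}) I cs :
  (forall m, I m <-> exists2 w, w \in A & (w <= m)%MM) ->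
  cone_chain I cs (fun=> True) -> pretty_cones cs ->
  pretty_clean (mgquot (monomial_ideal K A)).
Proof.
move=> defI chI pcs; set N := monomial_ideal K A.
have upI : upset I.
  by move=> m m' mm' /defI[w wA wm]; apply/defI; exists w => //; exact: lepm_trans mm'.
pose c0 : 'X_{1..n} * {set 'I_n} := (0%MM, set0).
have [upS disjS lastS] := cone_chain_stage c0 upI chI.
have NE p : p \in N <-> p \in monomial_submodule K I.
  split=> [/asboolP/in_monomial_idealP h|/(monomial_submoduleP _ upI) h].
    by apply/(monomial_submoduleP _ upI) => m /h h'; apply/defI.
  by apply/asboolP/in_monomial_idealP => m /h /defI.
have subS i : {subset N <= monomial_submodule K (stage I cs i)}.
  move=> p /NE; apply: sub_monomial_submodule => // m.
  exact: stage_ge.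
exists (size cs), (fun i => mgquot_sub (subS i)),
  (fun i => face_prime K (nth c0 cs i).2).
split; first split.
- move=> z; have [x ->] := mgquot_pi_surj z; rewrite (mgquot_subE (subS _)).
  rewrite /stage take0 /= -NE -(mgquot_pi0 N) mgquot_piP subr0.
  by split.
- move=> z; have [x ->] := mgquot_pi_surj z; rewrite (mgquot_subE (subS _)) lastS.
  by apply/monomial_submoduleP.
- move=> i ics; split.
  + move=> z; have [x ->] := mgquot_pi_surj z; rewrite !(mgquot_subE (subS _)).
    apply: sub_monomial_submodule => // m; rewrite (stageS I c0 ics); by left.
  + exact: face_prime_monomial_prime.
  + apply: iso_cone_factor; [exact: upS | exact: upS | exact: stageS | exact: disjS].
move=> i j /andP[ij jcs] /sub_face_prime sub; have ics := ltn_trans ij jcs.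
move: pcs => /(pairwiseP set0)/(_ i j); rewrite !inE !size_map.
move=> /(_ ics jcs ij); rewrite !(nth_map c0) // sub /= => /eqP -> //.
Qed.

(** * Building chains block by block *)

Section PrettyChains.
Variable n : nat.
Implicit Types (I J E : 'X_{1..n} -> Prop) (c : 'X_{1..n} * {set 'I_n}).
Implicit Types (D : {set 'I_n} -> Prop) (Z : {set 'I_n}).

Lemma add_coneE I c J :
  (forall m, J m <-> I m \/ cone c m) -> add_cone I c = J.
Proof. by move=> h; apply/funext => m; apply/propext; rewrite h. Qed.

Lemma cone_chain_cat I cs J cs' L :
  cone_chain I cs J -> cone_chain J cs' L -> cone_chain I (cs ++ cs') L.
Proof. by elim: cs I => [I -> //|c cs ih] I [dis up /ih h] /h. Qed.

(** [D] is an upper bound for the faces that occur; it is all that is needed to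
    check the order of the primes when chains are composed. *)
Definition pretty_chain I D J := exists cs,
  [/\ cone_chain I cs J, pretty_cones cs & forall c, c \in cs -> D c.2].

Lemma pretty_chain_refl I D : pretty_chain I D I.
Proof. by exists [::]. Qed.

Lemma pretty_chain_cat I D J D' L D'' :
  pretty_chain I D J -> pretty_chain J D' L ->
  (forall Z Z', D Z -> D' Z' -> Z' \subset Z -> Z' = Z) ->
  (forall Z, D Z \/ D' Z -> D'' Z) ->
  pretty_chain I D'' L.
Proof.
move=> [cs [ch pr dc]] [cs' [ch' pr' dc']] DD' sub; exists (cs ++ cs'); split.
- exact: cone_chain_cat ch ch'.
- rewrite /pretty_cones map_cat pairwise_cat; apply/and3P; split=> //.
  apply/allrelP => _ _ /mapP[c cc ->] /mapP[c' cc' ->].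
  apply/implyP => /DD' -> //; [exact: dc | exact: dc'].
- move=> c; rewrite mem_cat => /orP[/dc|/dc'] h; apply: sub; [by left | by right].
Qed.

Lemma pretty_chain_cons I c L : (forall m, cone c m -> ~ I m) ->
  upset (add_cone I c) -> pretty_chain (add_cone I c) (eq c.2) L ->
  pretty_chain I (eq c.2) L.
Proof.
move=> dis up [cs [ch pr dc]]; exists (c :: cs); split=> //.
  apply/andP; split; last exact: pr.
  by apply/allP => _ /mapP[c' cc ->]; rewrite (dc _ cc) eqxx implybT.
by move=> c'; rewrite inE => /orP[/eqP->|/dc].
Qed.

(** The part of [m] in the variables outside [Z]. *)
Definition off_part Z (m : 'X_{1..n}) : 'X_{1..n} :=
  [multinom if i \in Z then 0%N else m i | i < n].

Lemma off_partP Z (m m' : 'X_{1..n}) :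
  off_part Z m = off_part Z m' <-> (forall i, i \notin Z -> m i = m' i).
Proof.
split=> [/mnmP e i iZ|h]; first by have := e i; rewrite !mnmE (negPf iZ).
by apply/mnmP => i; rewrite !mnmE; case: ifPn => // /h.
Qed.

Lemma off_part_le Z m m' : (m <= m')%MM -> (off_part Z m <= off_part Z m')%MM.
Proof.
by move=> /mnm_lepP h; apply/mnm_lepP => i; rewrite !mnmE; case: ifP.
Qed.

Lemma mnm_le_deg_eq (m m' : 'X_{1..n}) :
  (m <= m')%MM -> (mdeg m' <= mdeg m)%N -> m = m'.
Proof.
move=> mm'; rewrite -(submK mm') mdegD -{2}[mdeg m]add0n leq_add2r leqn0 mdeg_eq0.
by move=> /eqP->; rewrite add0m.
Qed.

(** Group the monomials of [J] outside [I] by their part outside [Z].  Each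
    group is one cone, and there are finitely many.  Adding first those whose
    part outside [Z] has the largest degree keeps every stage closed: a multiple
    that leaves the group has a part outside [Z] of larger degree, so it has
    been added before. *)
Lemma pretty_block_slices I J Z N : upset I -> upset J ->
  (forall m, I m -> J m) ->
  (forall m, J m -> ~ I m -> forall i, i \notin Z -> (m i < N)%N) ->
  (forall m, J m -> ~ I m -> exists w : 'X_{1..n},
     [/\ (w <= m)%MM, forall i, i \notin Z -> w i = m i
       & forall m' : 'X_{1..n}, (forall i, i \notin Z -> m' i = m i) ->
           (J m' /\ ~ I m') <-> (w <= m')%MM]) ->
  pretty_chain I (eq Z) J.
Proof.
move=> upI upJ IJ bnd slice.
have [l lP] : exists l : seq 'X_{1..n}, forall m, J m -> ~ I m -> off_part Z m \in l.
  (* The parts outside Z have degree at most n * N. *)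
  exists [seq bmnm b | b <- enum {: 'X_{1..n < (n * N).+1}}] => m Jm nIm.
  have dm : (mdeg (off_part Z m) < (n * N).+1)%N.
    rewrite ltnS mdegE -[X in (X * N)%N]card_ord -sum_nat_const.
    apply: leq_sum => i _; rewrite mnmE; case: ifPn => // iZ.
    exact: ltnW (bnd m Jm nIm i iZ).
  by apply/mapP; exists (BMultinom dm); rewrite ?mem_enum.
elim: {l}(size l) {-2}l (leqnn (size l)) I upI IJ bnd slice lP
  => [|k ih] l lk I upI IJ bnd slice lP.
  suff -> : I = J by exact: pretty_chain_refl.
  apply/funext => m; apply/propext; split; first exact: IJ.
  move=> Jm; apply: contrapT => /(lP m Jm).
  by move: lk; rewrite leqn0 => /nilP->.
pose P k := `[< exists m, [/\ J m, ~ I m & mdeg (off_part Z m) = k] >].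
have [exP|noP] := pselect (exists k, P k); last first.
  suff -> : I = J by exact: pretty_chain_refl.
  apply/funext => m; apply/propext; split; first exact: IJ.
  move=> Jm; apply: contrapT => nIm; apply: noP.
  by exists (mdeg (off_part Z m)); apply/asboolP; exists m.
have bP j : P j -> (j <= \max_(x <- l) mdeg x)%N.
  by move=> /asboolP[m [Jm nIm <-]]; apply: leq_bigmax_seq => //; exact: lP.
case: (ex_maxnP exP bP) => j /asboolP[m [Jm nIm mj]] maxj.
have [w [wm wZ wP]] := slice m Jm nIm.
pose c := (w, Z).
have coneP m' : cone c m' <->
    [/\ forall i, i \notin Z -> m' i = m i, J m' & ~ I m'].
  split=> [[/= wm' h]|[h Jm' nIm']].
    have h' i : i \notin Z -> m' i = m i by move=> iZ; rewrite h // wZ.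
    by have [] := (wP m' h').2 wm'.
  split=> [|i /= iZ]; first by apply/(wP m' h).
  by rewrite h // wZ.
have upc : upset (add_cone I c).
  move=> m1 m2 m12 [Im1|cm1]; first by left; exact: upI Im1.
  have [Im2|nIm2] := pselect (I m2); [by left | right; apply/coneP].
  have /coneP[h1 Jm1 nIm1] := cm1.
  have Jm2 := upJ _ _ m12 Jm1; split=> //; apply/off_partP.
  move/off_partP : h1 => h1; rewrite -h1; apply/esym/mnm_le_deg_eq.
    exact: off_part_le.
  by rewrite h1 mj; apply: maxj; apply/asboolP; exists m2.
apply: (@pretty_chain_cons I c _ _ upc).
- by move=> m' /coneP[].
- have diffP m' : J m' -> ~ add_cone I c m' ->
      ~ I m' /\ ~ (forall i, i \notin Z -> m' i = m i).
    move=> Jm' nm'; have nI : ~ I m' by move=> Im'; apply: nm'; left.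
    by split=> // h; apply: nm'; right; apply/coneP.
  apply: (ih [seq x <- l | x != off_part Z m]) => //.
  + rewrite size_filter -ltnS; apply: leq_trans lk.
    rewrite -(count_predC (pred1 (off_part Z m)) l) addnC -addn1 leq_add2l.
    by rewrite -has_count has_pred1; exact: lP.
  + by move=> m' [/IJ//|/coneP[]].
  + by move=> m' Jm' /(diffP _ Jm')[nI _]; exact: bnd.
  + move=> m1 Jm1 /(diffP _ Jm1)[nI1 ne1].
    have [w1 [w1m w1Z w1P]] := slice m1 Jm1 nI1; exists w1; split=> // m' h.
    rewrite -w1P //; split=> [[Jm' /(diffP _ Jm')[]]//|[Jm' nI']].
    split=> // -[//|/coneP[h' _ _]]; apply: ne1 => i iZ.
    by rewrite -h // h'.
  + move=> m' Jm' /(diffP _ Jm')[nI ne]; rewrite mem_filter lP // andbT.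
    by apply/negP => /eqP/off_partP.
Qed.

(** The form in which blocks arise: membership depends on the variables outside
    [Z], except possibly for the requirement that [s] occurs.  The vertex is
    then the part outside [Z], times x_s when that requirement is active. *)
Lemma pretty_block I J Z (s : 'I_n) (R R' : 'X_{1..n} -> Prop) N :
  upset I -> upset J -> (forall m, I m -> J m) ->
  (forall m, (J m /\ ~ I m) <-> (R m /\ ((0 < m s)%N \/ R' m))) ->
  (forall m m' : 'X_{1..n}, (forall i, i \notin Z -> m i = m' i) -> R m -> R m') ->
  (forall m m' : 'X_{1..n}, (forall i, i \notin Z -> m i = m' i) -> R' m -> R' m') ->
  (forall m, R m -> s \in Z \/ R' m) ->
  (forall m, R m -> 0 < m s \/ R' m -> forall i, i \notin Z -> (m i < N)%N)%N ->
  pretty_chain I (eq Z) J.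
Proof.
move=> upI upJ IJ diff RZ R'Z sZ bnd; apply: (@pretty_block_slices _ _ _ N) => //.
  move=> m Jm nIm; have [Rm h] := (diff m).1 (conj Jm nIm).
  exact: bnd.
move=> m Jm nIm; have [Rm h] := (diff m).1 (conj Jm nIm).
exists [multinom if i \in Z then ((i == s) && ~~ `[< R' m >] : nat) else m i | i < n].
split=> [|i iZ|m' hm'].
- apply/mnm_lepP => i; rewrite mnmE; case: ifP => // _.
  case: eqP => [->|//]; case: asboolP => // nR' /=; by case: h.
- by rewrite mnmE (negPf iZ).
have hm i : i \notin Z -> m i = m' i by move=> /hm' ->.
rewrite diff; split=> [[Rm' h']|/mnm_lepP le].
  apply/mnm_lepP => i; rewrite mnmE; case: ifPn => [_|/hm -> //].
  case: eqP => [->|//]; case: asboolP => //= nR'.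
  by case: h' => // /(R'Z _ _ hm').
split; first exact: RZ hm Rm.
have [R'm|nR'] := pselect (R' m); first by right; exact: R'Z hm R'm.
have [s_Z|//] := sZ m Rm; left.
by have := le s; rewrite mnmE s_Z eqxx /= asboolF.
Qed.

End PrettyChains.

(** * Multiplication by a monomial *)

Section Shift.
Variable n : nat.
Implicit Types (I J : 'X_{1..n} -> Prop) (c : 'X_{1..n} * {set 'I_n}).
Implicit Types (h m w : 'X_{1..n}).

Notation total := (fun _ : 'X_{1..n} => True).

(** The monomials of the ideal [h * I]. *)
Definition shift h I : 'X_{1..n} -> Prop := fun m => (h <= m)%MM /\ I (m - h)%MM.

Lemma shift_add h1 h2 I : shift (h1 + h2) I = shift h1 (shift h2 I).
Proof.
apply/funext => m; apply/propext; rewrite /shift.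
rewrite -submDA; split=> [[/mnm_lepP h Im]|[/mnm_lepP h1m [/mnm_lepP h2m Im]]].
  split; first by apply/mnm_lepP => i; have := h i; rewrite mnmDE; lia.
  by split=> //; apply/mnm_lepP => i; have := h i; rewrite mnmDE mnmBE; lia.
split=> //; apply/mnm_lepP => i; have := h1m i; have := h2m i.
by rewrite mnmDE mnmBE; lia.
Qed.

Lemma shift0 I : shift 0%MM I = I.
Proof.
apply/funext => m; apply/propext; rewrite /shift subm0.
by split=> [[]//|Im]; split=> //; apply/mnm_lepP => i; rewrite mnm0E.
Qed.

Lemma upset_shift h I : upset I -> upset (shift h I).
Proof.
move=> upI m m' mm' [hm Im]; split; first exact: lepm_trans mm'.
by apply: upI Im; apply/mnm_lepP => i; rewrite !mnmBE; have /mnm_lepP/(_ i) := mm'; lia.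
Qed.

Lemma cone_shift h c m :
  cone ((c.1 + h)%MM, c.2) m <-> (h <= m)%MM /\ cone c (m - h)%MM.
Proof.
rewrite /cone /=; split=> [[/mnm_lepP wm e]|[/mnm_lepP hm [/mnm_lepP wm e]]].
  split; first by apply/mnm_lepP => i; have := wm i; rewrite mnmDE; lia.
  split; first by apply/mnm_lepP => i; have := wm i; rewrite mnmDE mnmBE; lia.
  by move=> i /e; rewrite mnmDE mnmBE; lia.
split; first by apply/mnm_lepP => i; have := wm i; have := hm i; rewrite mnmDE mnmBE; lia.
by move=> i /e; have := hm i; rewrite mnmDE mnmBE; lia.
Qed.

Lemma cone_chain_shift h I cs J : cone_chain I cs J ->
  cone_chain (shift h I) [seq ((c.1 + h)%MM, c.2) | c <- cs] (shift h J).
Proof.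
elim: cs I => [|c cs ih] I /=; first by move=> ->.
move=> [dis up ch].
have e : add_cone (shift h I) ((c.1 + h)%MM, c.2) = shift h (add_cone I c).
  apply: add_coneE => m; rewrite cone_shift /shift /add_cone; tauto.
split; last by rewrite e; exact: ih.
  by move=> m /cone_shift[_ cm] [_ Im]; exact: dis cm Im.
by rewrite e; exact: upset_shift.
Qed.

(** A cone in all directions contains multiples of every element of [I]. *)
Lemma cone_chain_not_full I cs J w0 : upset I -> I w0 -> cone_chain I cs J ->
  forall c, c \in cs -> c.2 != setT.
Proof.
elim: cs I => [|c cs ih] I upI Iw //= [dis up ch] c'.
rewrite inE => /orP[/eqP->|]; last by apply: ih ch _ => //; left.
apply/eqP => cT; apply: (dis (c.1 + w0)%MM).
  by split=> [|i]; rewrite ?lem_addr // cT inE.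
exact: upI (lem_addl _ _) Iw.
Qed.

(** Multiply the chain by x_i; what is missing is the set of monomials without
    x_i, a single cone whose face omits only i.  Coming last it is harmless,
    since it could only be properly contained in the face of all variables. *)
Lemma pretty_shift_var (i : 'I_n) I w0 : upset I -> I w0 ->
  pretty_chain I (fun=> True) total ->
  pretty_chain (shift U_(i)%MM I) (fun=> True) total.
Proof.
move=> upI Iw [cs [ch pr _]].
exists (rcons [seq ((c.1 + U_(i))%MM, c.2) | c <- cs] (0%MM, ~: [set i])).
split=> //.
  rewrite -cats1; apply: cone_chain_cat (cone_chain_shift U_(i)%MM ch) _.
  have e : add_cone (shift U_(i)%MM total) (0%MM, ~: [set i]) = total.
    apply: add_coneE => m; rewrite /shift /cone /=; split=> // _.
    have [mi|mi] := posnP (m i); last by left; split=> //; rewrite lep1mP -lt0n.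
    right; split=> [|j]; first by apply/mnm_lepP => j; rewrite mnm0E.
    by rewrite !inE negbK mnm0E => /eqP->.
  split; last by rewrite e.
    move=> m [_ /(_ i)]; rewrite !inE eqxx /= mnm0E => /(_ isT) mi [].
    by rewrite lep1mP mi.
  by rewrite e.
rewrite /pretty_cones map_rcons -cats1 pairwise_cat -map_comp.
apply/and3P; split=> //; apply/allrelP => Z Z' /mapP[c cc ->].
rewrite inE => /eqP->; apply/implyP => /= sub.
rewrite eq_sym eqEsubset sub andbT; apply/subsetP => j jc; rewrite !inE.
apply: contra (cone_chain_not_full upI Iw ch cc) => /eqP ji.
apply/eqP/setP => k; rewrite !inE; have [->|ki] := eqVneq k i; first by rewrite -ji.
by apply: (subsetP sub); rewrite !inE.
Qed.

Lemma pretty_shift h I w0 : upset I -> I w0 ->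
  pretty_chain I (fun=> True) total ->
  pretty_chain (shift h I) (fun=> True) total.
Proof.
move=> upI Iw chI; have [k hk] := ubnP (mdeg h).
elim: k h hk => // k ih h hk; have [->|] := eqVneq h 0%MM; first by rewrite shift0.
rewrite -mdeg_eq0 mdegE sum_nat_eq0 negb_forall => /existsP[i /= hi].
have hE : h = (U_(i) + (h - U_(i)))%MM by rewrite addmC submK // lep1mP.
have hd : (mdeg h = (mdeg (h - U_(i))).+1)%N by rewrite {1}hE mdegD mdeg1.
rewrite hE shift_add; apply: (@pretty_shift_var _ _ (h - U_(i) + w0)%MM).
- exact: upset_shift.
- by split; rewrite ?lem_addr // addmC addmK.
- by apply: ih; rewrite -ltnS -hd.
Qed.

End Shift.

(** * The lexicographic order *)

Section Lex.
Variable n : nat.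
Implicit Types (a b m w : 'X_{1..n}).

Definition lexlt a b :=
  exists i : 'I_n, (a i < b i)%N /\ forall j : 'I_n, (j < i)%N -> a j = b j.

Lemma lexleE a b : lexle a b <-> a = b \/ lexlt a b.
Proof.
have ltE : reflect (lexlt a b)
    ((multinom_val a : n.-tuplelexi nat) < (multinom_val b : n.-tuplelexi nat))%O.
  apply: (iffP ltxi_tuplePlt) => [[k h1 h2]|[k [h1 h2]]]; first by exists k.
  by exists k.
rewrite /lexle le_eqVlt; split=> [/orP[/eqP e|/ltE]|[->|/ltE->]].
- by left; exact: val_inj.
- by right.
- by rewrite eqxx.
- by rewrite orbT.
Qed.

Lemma lexlt_irr a : ~ lexlt a a.
Proof. by move=> [i []]; rewrite ltnn. Qed.

Lemma lexlt_asym a b : lexlt a b -> ~ lexlt b a.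
Proof.
move=> [i [h1 h2]] [j [h3 h4]].
have [ij|ji|/val_inj e] := ltngtP i j; first by have := h4 _ ij; lia.
  by have := h2 _ ji; lia.
by rewrite e in h1; lia.
Qed.

Lemma lexlt_total a b : a != b -> lexlt a b \/ lexlt b a.
Proof.
move=> ab; have [i abi imin] : exists2 i : 'I_n, a i != b i &
    forall j : 'I_n, (j < i)%N -> a j = b j.
  have [i0 hi0] : exists i, a i != b i.
    by apply/existsP; apply: contraNT ab; rewrite negb_exists => /forallP h;
       apply/eqP/mnmP => i; apply/eqP; rewrite -[_ == _]negbK h.
  case: (@arg_minnP _ i0 (fun i => a i != b i) (fun i : 'I_n => i : nat) hi0) => i hi him.
  exists i => // j ji; apply/eqP/negPn/negP => /him; lia.
have [lt|gt|e] := ltngtP (a i) (b i).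
- by left; exists i.
- by right; exists i; split=> // j /imin.
- by rewrite e eqxx in abi.
Qed.

Lemma lexle_lt a b : lexle a b <-> ~ lexlt b a.
Proof.
rewrite lexleE; split=> [[->|]|nba]; first exact: lexlt_irr.
  by move=> /lexlt_asym.
have [->|/lexlt_total[]] := eqVneq a b; [by left | by right | by []].
Qed.

(** The test is made at each index up to which the exponents agree, which spares
    the users of an order hypothesis the search for the first difference. *)
Lemma lexleP a b : lexle a b <->
  (forall i : 'I_n, (forall j : 'I_n, (j < i)%N -> a j = b j) -> (a i <= b i)%N).
Proof.
rewrite lexle_lt; split=> [nl i h|h [i [lt e]]].
  by rewrite leqNgt; apply/negP => lt; apply: nl; exists i; split=> // j /h ->.
have := h i; rewrite leqNgt lt => h'; have // : false by apply: h' => j /e ->.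
Qed.

Lemma lexle_add2r h a b : lexle (a + h)%MM (b + h)%MM <-> lexle a b.
Proof.
rewrite !lexleP; split=> H i e.
  have := H i; rewrite !mnmDE leq_add2r; apply => j /e.
  by rewrite !mnmDE => ->.
rewrite !mnmDE leq_add2r; apply: H => j /e.
by rewrite !mnmDE => /eqP; rewrite eqn_add2r => /eqP.
Qed.

Lemma mnm_deg_between a m d : (a <= m)%MM -> (mdeg a <= d <= mdeg m)%N ->
  exists w, [/\ (a <= w)%MM, (w <= m)%MM & mdeg w = d].
Proof.
have [k hk] := ubnP (d - mdeg a); elim: k a hk => // k ih a hk am /andP[ad dm].
have [e|ne] := eqVneq (mdeg a) d; first by exists a; split=> //; exact: lepm_refl.
have [i ami] : exists i, (a i < m i)%N.
  apply/existsP; apply: contraTT dm; rewrite negb_exists => /forallP h.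
  rewrite -ltnNge; apply: leq_ltn_trans (_ : mdeg a < d)%N; last by rewrite ltn_neqAle ne.
  by rewrite !mdegE; apply: leq_sum => i _; rewrite leqNgt.
have da : mdeg (a + U_(i))%MM = (mdeg a).+1 by rewrite mdegD mdeg1 addn1.
have [|||w [aw wm dw]] := ih (a + U_(i))%MM.
- by rewrite da; lia.
- apply/mnm_lepP => j; rewrite mnmDE mnm1E; have [<-|_] := eqVneq i j; first by rewrite addn1.
  by rewrite addn0; exact: (mnm_lepP am).
- by rewrite da; lia.
by exists w; split=> //; exact: lepm_trans (lem_addr _ _) aw.
Qed.

End Lex.

(** * Lexsegments whose bounds differ in the first variable that occurs *)

Section Core.
Variables (n d : nat) (s : 'I_n) (u v : 'X_{1..n}).
Implicit Types (m w : 'X_{1..n}) (i j l : 'I_n) (k : nat).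
Hypotheses (du : mdeg u = d) (dv : mdeg v = d).
Hypothesis v0 : forall i, (i <= s)%N -> v i = 0%N.
Hypothesis u0 : forall i, (i < s)%N -> u i = 0%N.
Hypothesis us : (0 < u s)%N.

Notation total := (fun _ : 'X_{1..n} => True).

(** The exponents of [m] strictly between s and k are lexicographically at least
    those of [v].  The condition before the index i is an inequality and not an
    equality, so that the negated property visibly passes to divisors; equality
    is recovered at the smallest i in [prefix_lt_first].  For s < k < n this
    is the initial lexsegment ideal of [v], in the variables after s, saturated
    with respect to the variables of index at least k. *)
Definition prefix_ge k m := ~ exists i, [/\ (s < i)%N, (i < k)%N, (m i < v i)%N
  & forall l, (s < l)%N -> (l < i)%N -> (m l <= v l)%N].

Lemma upset_prefix_ge k : upset (prefix_ge k).
Proof.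
move=> m m' /mnm_lepP mm' h [i [si ik mi hi]]; apply: h; exists i; split=> //.
  exact: leq_ltn_trans (mm' i) mi.
by move=> l sl li; exact: leq_trans (mm' l) (hi l sl li).
Qed.

Lemma prefix_ge_le k k' m : (k <= k')%N -> prefix_ge k' m -> prefix_ge k m.
Proof.
move=> kk' h [i [si ik mi hi]]; apply: h; exists i; split=> //.
exact: leq_trans kk'.
Qed.

Lemma prefix_ge0 k m : (k <= s.+1)%N -> prefix_ge k m.
Proof. by move=> ks [i [si ik _ _]]; lia. Qed.

Lemma prefix_ge_ext k m m' : (forall i, (s < i)%N -> (i < k)%N -> m i = m' i) ->
  prefix_ge k m -> prefix_ge k m'.
Proof.
move=> e h [i [si ik mi hi]]; apply: h; exists i; split=> //; first by rewrite e.
by move=> l sl li; rewrite e //; [exact: hi | exact: ltn_trans li ik].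
Qed.

Lemma prefix_lt_first k m : ~ prefix_ge k m -> exists i,
  [/\ (s < i)%N, (i < k)%N, (m i < v i)%N
    & forall l, (s < l)%N -> (l < i)%N -> m l = v l].
Proof.
move=> /contrapT [i0 [si0 ik0 mi0 hi0]].
have Pi0 : [pred i : 'I_n | (s < i)%N && (m i < v i)%N] i0 by rewrite /= si0.
case: (@arg_minnP _ i0 _ (fun i : 'I_n => i : nat) Pi0) => i /andP[si mi] imin.
have ii0 := imin _ Pi0.
exists i; split=> //; first exact: leq_ltn_trans ik0.
move=> l sl li; apply/eqP; rewrite eqn_leq hi0 //; last exact: leq_trans ii0.
rewrite leqNgt; apply/negP => ml.
by have := imin l; rewrite /= sl ml => /(_ isT); rewrite leqNgt li.
Qed.

Lemma mnm_le_mdeg m i : (m i <= mdeg m)%N.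
Proof. by rewrite mdegE (bigD1 i) //= leq_addr. Qed.

Lemma v_le i : (v i <= d)%N.
Proof. by rewrite -dv mnm_le_mdeg. Qed.

Definition deg_after m := (\sum_(i < n | (s < i)%N) m i)%N.

Lemma deg_after_ge m i : (s < i)%N -> (m i <= deg_after m)%N.
Proof. by move=> si; rewrite /deg_after (bigD1 i) //= leq_addr. Qed.

(** If the degree is below d every exponent is.  Otherwise the comparison with
    [v] fails at a first index, which is at least k, and up to it the exponents
    are bounded by those of [v]. *)
Lemma prefix_bound k m : prefix_ge k m -> ~ ((d <= deg_after m)%N /\ prefix_ge n m) ->
  forall i, (s < i)%N -> (i <= k)%N -> (m i <= d)%N.
Proof.
move=> hk ndeg i si ik; have [dm|dm] := leqP d (deg_after m); last first.
  by have := deg_after_ge m si; lia.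
have /prefix_lt_first[j [sj jn mj hj]] : ~ prefix_ge n m by move=> h; apply: ndeg.
have kj : (k <= j)%N.
  rewrite leqNgt; apply/negP => jk; apply: hk; exists j; split=> // l sl lj.
  by rewrite hj.
have [e|ne] := eqVneq i j; first by rewrite e (leq_trans (ltnW mj)) ?v_le.
by rewrite hj ?v_le //; move: ne; rewrite -val_eqE /=; lia.
Qed.

Definition segment w := [/\ mdeg w = d, lexle v w & lexle w u].

Lemma segment_below w i : segment w -> (i < s)%N -> w i = 0%N.
Proof.
move=> [_ _ /lexleP h]; have [k ik] := ubnP (i : nat).
elim: k i ik => // k ih i ik si; apply/eqP; rewrite -leqn0 -(u0 si).
by apply: h => j ji; rewrite u0 ?ih //; lia.
Qed.

Lemma segment_first w : segment w -> (w s <= u s)%N.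
Proof.
move=> sw; have [_ _ /lexleP h] := sw; apply: h => j js.
by rewrite (segment_below sw) // u0.
Qed.

(** At x_s the exponent decides both comparisons at once. *)
Lemma segment_mid w : mdeg w = d -> (forall i, (i < s)%N -> w i = 0%N) ->
  (0 < w s < u s)%N -> segment w.
Proof.
move=> dw w0 /andP[ws wu]; split=> //; apply/lexleP => i e.
- have [is_|si] := leqP i s; first by rewrite v0.
  by have := e _ si; rewrite v0 // => e'; rewrite -e' in ws.
- have [lt|si|/val_inj ->] := ltngtP i s; [by rewrite w0 | | exact: ltnW].
  by have := e _ si; lia.
Qed.

Lemma segment_zero w : w s = 0%N -> segment w <->
  [/\ mdeg w = d, forall i, (i < s)%N -> w i = 0%N & prefix_ge n w].
Proof.
move=> ws; split=> [sw|[dw w0 pw]].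
  have [dw /lexleP vw _] := sw; split=> // [i|]; first exact: segment_below.
  apply: contrapT => /prefix_lt_first[i [si _ wi hi]].
  suff : (v i <= w i)%N by lia.
  apply: vw => j ji; have [js|sj] := leqP j s; last by rewrite hi.
  rewrite v0 //; have [lt|gt|/val_inj ->] := ltngtP j s; [|lia|by rewrite ws].
  by rewrite (segment_below sw).
split=> //; apply/lexleP => i e.
- have [is_|si] := leqP i s; first by rewrite v0.
  rewrite leqNgt; apply/negP => lt; apply: pw; exists i; split=> // l _ li.
  by rewrite e.
- have [lt|si|/val_inj ->] := ltngtP i s; [by rewrite w0 | | by rewrite ws].
  by have := e _ si; lia.
Qed.

Definition seg_ideal m := exists2 w, segment w & (w <= m)%MM.

(** The saturation of [seg_ideal] with respect to x_s: exponents of x_s are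
    ignored. *)
Definition seg_sat m :=
  exists2 w, segment w & forall i, i != s -> (w i <= m i)%N.

(** The part of [seg_sat] coming from generators divisible by x_s. *)
Definition seg_high m :=
  exists w, [/\ segment w, (0 < w s)%N & forall i, i != s -> (w i <= m i)%N].

(** The saturation of [seg_high] with respect to x_q. *)
Definition high_sat (q : 'I_n) m :=
  exists w, [/\ segment w, (0 < w s)%N
    & forall i, i != s -> i != q -> (w i <= m i)%N].

(** The part of [seg_sat] coming from generators without x_s: an initial
    lexsegment ideal, here in closed form. *)
Definition seg_low m := (d <= deg_after m)%N /\ prefix_ge n m.

Lemma seg_low_intro w m : segment w -> w s = 0%N ->
  (forall i, i != s -> (w i <= m i)%N) -> seg_low m.
Proof.
move=> sw ws wm; have [dw w0 pw] := (segment_zero ws).1 sw; split.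
  rewrite -dw mdegE (bigID (fun i : 'I_n => s < i)%N) /= [X in (_ + X)%N]big1.
    rewrite addn0; apply: leq_sum => i si; apply: wm.
    by apply: contraTneq si => ->; rewrite ltnn.
  move=> i; rewrite -leqNgt leq_eqVlt => /orP[/eqP/val_inj->//|]; exact: w0.
apply: (@upset_prefix_ge n w) => //; apply/mnm_lepP => i.
by have [->|/wm//] := eqVneq i s; rewrite ws.
Qed.

(** A monomial of degree at least d that is at least [v] has a divisor of degree
    exactly d that is at least [v]: if [v] divides it, take [v]; otherwise it
    exceeds [v] at a first index i, and any divisor of degree d extending the
    exponents of [v] before i and one more x_i than in [v] will do. *)
Lemma seg_low_elim m : seg_low m ->
  exists w, [/\ segment w, w s = 0%N & (w <= m)%MM].
Proof.
move=> [dm pm].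
pose m' : 'X_{1..n} := [multinom if (s < i)%N then m i else 0%N | i < n].
have m'm : (m' <= m)%MM by apply/mnm_lepP => i; rewrite mnmE; case: ifP.
have dm' : mdeg m' = deg_after m.
  rewrite mdegE /deg_after [RHS]big_mkcond /=.
  by apply: eq_bigr => i _; rewrite mnmE.
have pm' : prefix_ge n m' by apply: prefix_ge_ext pm => i si _; rewrite mnmE si.
suff [a [am' da pa]] : exists a, [/\ (a <= m')%MM, (mdeg a <= d)%N & prefix_ge n a].
  have [|w [aw wm' dw]] := @mnm_deg_between _ a m' d am'; first by rewrite da dm'.
  have w0 i : (i <= s)%N -> w i = 0%N.
    by move=> si; have := mnm_lepP wm' i; rewrite mnmE ltnNge si leqn0 => /eqP.
  exists w; rewrite w0 //; split=> //; last exact: lepm_trans m'm.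
  apply/segment_zero; rewrite ?w0 //; split=> // [i si|]; first by rewrite w0 // ltnW.
  exact: upset_prefix_ge aw pa.
have [vm'|] := boolP (v <= m')%MM.
  by exists v; rewrite dv; split=> // -[i [_ _]]; rewrite ltnn.
move=> /mnm_lepP/existsNP[i0 /negP]; rewrite -ltnNge => mi0.
have ne : m' != v by apply: contraTneq mi0 => ->; rewrite ltnn.
have vs i : (0 < v i)%N -> (s < i)%N by have [/v0 ->|] := leqP i s.
have [[i [mi hi]]|[i [mi hi]]] := lexlt_total ne.
  case: pm'; exists i; split=> //; first by apply: vs; lia.
  by move=> l _ /hi ->.
have si : (s < i)%N by move: mi; rewrite mnmE; case: ifP => //; rewrite ltn0.
have ii0 : (i < i0)%N.
  by have [//|gt|/val_inj e] := ltngtP i i0; [have := hi _ gt; lia | move: mi; rewrite e; lia].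
(* The degree is at most d because v has an exponent at i0 > i to spare. *)
exists [multinom if (l < i)%N then v l else if l == i then (v i).+1 else 0%N | l < n].
split.
- apply/mnm_lepP => l; rewrite mnmE; case: ifP => [/hi->//|_].
  by case: eqP => [->|].
- rewrite -dv -(leq_add2r 1) -{1}(mdeg1 i0) -(mdeg1 i) -!mdegD !mdegE.
  apply: leq_sum => l _; rewrite !mnmDE mnmE !mnm1E.
  have [e|nl] := eqVneq i0 l.
    have li : (l < i)%N = false by rewrite -e; lia.
    have -> : (l == i) = false by rewrite -val_eqE /= -e; lia.
    by rewrite li -e; have := v i0; lia.
  by rewrite addn0; case: ifP => [|_]; [lia|]; rewrite eq_sym; case: eqP => [->|]; lia.
- move=> [l [sl _]]; rewrite mnmE; have [li|il|/val_inj e] := ltngtP l i; first lia.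
    by move=> _ /(_ i si il); rewrite mnmE ltnn eqxx ltnn.
  by rewrite e eqxx; lia.
Qed.

Lemma seg_ideal_low m : seg_low m -> seg_ideal m.
Proof. by move=> /seg_low_elim[w [sw _ wm]]; exists w. Qed.

Lemma seg_satE m : seg_sat m <-> seg_high m \/ seg_low m.
Proof.
split=> [[w sw wm]|[[w [sw _ wm]]|/seg_low_elim[w [sw _ /mnm_lepP wm]]]].
- have [ws|ws] := posnP (w s); first by right; exact: seg_low_intro sw ws wm.
  by left; exists w.
- by exists w.
- by exists w.
Qed.

Lemma seg_ideal_sat m : seg_ideal m -> seg_sat m.
Proof. by move=> [w sw /mnm_lepP wm]; exists w. Qed.

Lemma upset_seg_ideal : upset seg_ideal.
Proof. by move=> m m' mm' [w sw wm]; exists w => //; exact: lepm_trans mm'. Qed.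

Lemma upset_seg_sat : upset seg_sat.
Proof.
move=> m m' /mnm_lepP mm' [w sw wm]; exists w => // i /wm h.
exact: leq_trans h (mm' i).
Qed.

Lemma upset_high_sat q : upset (high_sat q).
Proof.
move=> m m' /mnm_lepP mm' [w [sw ws wm]]; exists w; split=> // i is_ /(wm i is_) h.
exact: leq_trans h (mm' i).
Qed.

Lemma d_gt0 : (0 < d)%N.
Proof. by rewrite -du; apply: leq_trans us (mnm_le_mdeg u s). Qed.

(** x_s x_i^(d-1): where these lie in the segment, they bound the exponents of
    x_i outside the ideal. *)
Definition spike i : 'X_{1..n} := (U_(s) + U_(i) *+ d.-1)%MM.

Lemma spikeE i l : spike i l = ((s == l) + (i == l) * d.-1)%N.
Proof. by rewrite /spike mnmDE mulmnE !mnm1E. Qed.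

Lemma mdeg_spike i : mdeg (spike i) = d.
Proof. by rewrite /spike mdegD mdegMn !mdeg1 mul1n add1n prednK // d_gt0. Qed.

Lemma spike_le i m : (d.-1 <= m i)%N -> forall l, l != s -> (spike i l <= m l)%N.
Proof.
move=> dm l ls; rewrite spikeE eq_sym (negPf ls) add0n.
by case: eqP => [<-|]; rewrite ?mul1n ?mul0n.
Qed.

Lemma spike_at i : (s < i)%N -> spike i s = 1%N.
Proof. by move=> si; rewrite spikeE eqxx; case: eqP => [e|]; [rewrite e ltnn in si|]. Qed.

Lemma segment_spike_mid i : (s < i)%N -> (1 < u s)%N -> segment (spike i).
Proof.
move=> si us2; apply: segment_mid; rewrite ?mdeg_spike ?spike_at // => l ls.
by rewrite spikeE -!val_eqE /=; lia.
Qed.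

(** The sum of (x_s) and of the saturation, with respect to the last variable,
    of the slice of the ideal in x_s-degree 0. *)
Definition slice_hull m := (0 < m s)%N \/ prefix_ge n.-1 m.

Lemma upset_slice_hull : upset slice_hull.
Proof.
move=> m m' mm' [ms|pm]; last by right; exact: upset_prefix_ge pm.
by left; apply: leq_trans ms (mnm_lepP mm' s).
Qed.

Lemma upset_and I J : upset I -> upset J -> upset (fun m => I m /\ J m).
Proof. by move=> uI uJ m m' mm' [Im Jm]; split; [exact: uI Im | exact: uJ Jm]. Qed.

Lemma upset_or I J : upset I -> upset J -> upset (fun m => I m \/ J m).
Proof. by move=> uI uJ m m' mm' [Im|Jm]; [left; exact: uI Im | right; exact: uJ Jm]. Qed.

(** Faces of the first part, and of the blocks whose variables after x_s have
    bounded exponents. *)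
Definition below_s : {set 'I_n} := [set l : 'I_n | (l < s)%N].
Definition upto_s : {set 'I_n} := [set l : 'I_n | (l <= s)%N].

(** Outside the ideal, the exponent of x_s is less than in [u], else the witness
    for [seg_sat] divides the monomial.  The other exponents are bounded by
    [segment_spike_mid] if x_s occurs, and by [prefix_bound] if it does not. *)
Lemma pretty_saturation :
  pretty_chain seg_ideal (eq below_s) (fun m => seg_sat m /\ slice_hull m).
Proof.
have le_sub m m' w : segment w -> (forall i, i \notin below_s -> m i = m' i) ->
    forall i, (w i <= m i)%N -> (w i <= m' i)%N.
  move=> sw e i; have [lt|gt] := ltnP i s; first by rewrite (segment_below sw).
  by rewrite -e // inE -leqNgt.
have RI m m' : (forall i, i \notin below_s -> m i = m' i) -> seg_ideal m -> seg_ideal m'.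
  move=> e [w sw /mnm_lepP wm]; exists w => //; apply/mnm_lepP => i.
  exact: le_sub (wm i).
pose R m := (seg_sat m /\ slice_hull m) /\ ~ seg_ideal m.
apply: (@pretty_block _ _ _ _ s R (fun=> True) d.+1) => //.
- exact: upset_seg_ideal.
- exact: upset_and upset_seg_sat upset_slice_hull.
- move=> m Im; split; first exact: seg_ideal_sat.
  have [w sw wm] := Im; have [ws|ws] := posnP (w s); last first.
    by left; apply: leq_trans ws (mnm_lepP wm s).
  right; apply: upset_prefix_ge wm _; have [_ _ pw] := (segment_zero ws).1 sw.
  by apply: prefix_ge_le pw; exact: leq_pred.
- by move=> m; split=> [h|[]//]; split=> //; right.
- move=> m m' e [[Tm Bm] nI]; split; last first.
    by move=> Im'; apply: nI; apply: RI Im' => i /e.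
  split.
    by have [w sw wm] := Tm; exists w => // i /wm; exact: le_sub.
  case: Bm => [ms|pm]; [left; rewrite -e ?inE ?ltnn // | right].
  by apply: prefix_ge_ext pm => i si _; apply: e; rewrite inE -leqNgt ltnW.
- by right.
- move=> m [[Tm Bm] nI] _ i; rewrite inE -leqNgt ltnS => si.
  have msu : (m s < u s)%N.
    rewrite ltnNge; apply/negP => ums; apply: nI; have [w sw wm] := Tm; exists w => //.
    apply/mnm_lepP => l; have [->|/wm //] := eqVneq l s.
    by apply: leq_trans ums; exact: segment_first.
  have usd : (u s <= d)%N by rewrite -du mnm_le_mdeg.
  have [e|ne] := eqVneq i s; first by rewrite e; lia.
  have {}si : (s < i)%N by move: ne; rewrite -val_eqE /=; lia.
  have [ms|ms] := posnP (m s).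
    case: Bm => [|pm]; first by rewrite ms.
    apply: (prefix_bound pm) => // [h|]; first by apply: nI; exact: seg_ideal_low.
    by have := ltn_ord i; lia.
  rewrite leqNgt; apply/negP => dm; apply: nI; exists (spike i).
    by apply: segment_spike_mid => //; lia.
  apply/mnm_lepP => l; have [->|ls] := eqVneq l s; first by rewrite spike_at.
  by apply: (@spike_le i) => //; lia.
Qed.

Definition tail_face (j : 'I_n) : {set 'I_n} := [set l : 'I_n | (l < s)%N || (j < l)%N].

(** Passing from the prefix of length j+1 to that of length j adds the monomials
    that agree with [v] before x_j and are smaller at x_j; the variables after
    x_j are free. *)
Lemma pretty_tail_faces k : (k <= n.-1)%N ->
  pretty_chain (fun m => (0 < m s)%N \/ prefix_ge k m)
    (fun Z => exists2 j : 'I_n, (s < j < k)%N & Z = tail_face j) total.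
Proof.
elim: k => [|k ih] kn.
  have -> : (fun m => (0 < m s)%N \/ prefix_ge 0 m) = total.
    by apply/funext => m; apply/propext; split=> // _; right; exact: prefix_ge0.
  exact: pretty_chain_refl.
have [ks|sk] := leqP k s.
  have -> : (fun m => (0 < m s)%N \/ prefix_ge k.+1 m) = total.
    by apply/funext => m; apply/propext; split=> // _; right; exact: prefix_ge0.
  exact: pretty_chain_refl.
have kn' : (k < n)%N by lia.
pose j := Ordinal kn'; rewrite -[k]/(nat_of_ord j) in kn sk ih *.
apply: (@pretty_chain_cat _ _ (eq (tail_face j)) _ _ _ _ _ (ih _)); last 1 first.
- by move=> Z [<-|[i /andP[si ij] ->]]; [exists j | exists i]; rewrite ?sk ?ltnSn ?si ?ltnS // ltnW.
- pose R m := [/\ m s = 0%N, prefix_ge j m & ~ prefix_ge j.+1 m].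
  have sj_off : s \notin tail_face j by rewrite inE ltnn ltnNge ltnW.
  have upA k' : upset (fun m => (0 < m s)%N \/ prefix_ge k' m).
    apply: upset_or (@upset_prefix_ge _) => m m' mm' ms.
    exact: leq_trans ms (mnm_lepP mm' s).
  apply: (@pretty_block _ _ _ _ s R (fun=> True) d.+1) => //.
  + move=> m [ms|pm]; [by left | right; exact: prefix_ge_le pm].
  + move=> m; split=> [[[ms|pm] h]|[[ms pm npm] _]].
    * by case: h; left.
    * have ms : m s = 0%N by apply/eqP; rewrite -leqn0 leqNgt; apply/negP => ms; apply: h; left.
      by split; [split=> // pm'; apply: h; right | right].
    * by split=> [|[|//]]; [right | rewrite ms].
  + have ext k' m m' : (k' <= j.+1)%N -> (forall i, i \notin tail_face j -> m i = m' i) ->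
        prefix_ge k' m -> prefix_ge k' m'.
      move=> kj e; apply: prefix_ge_ext => i si ik; apply: e.
      by rewrite inE negb_or -!leqNgt; lia.
    move=> m m' e [ms pm npm]; split; first by rewrite -e.
      exact: ext e pm.
    by move=> pm'; apply: npm; apply: ext pm' => // i /e.
  + by right.
  + move=> m [ms pm npm] _ i; rewrite inE negb_or -!leqNgt ltnS => /andP[si ij].
    have [-> |ne] := eqVneq i s; first by rewrite ms.
    have {}si : (s < i)%N by move: ne; rewrite -val_eqE /=; lia.
    apply: (prefix_bound pm) => // -[_ pn]; apply: npm.
    exact: prefix_ge_le pn.
- by lia.
- move=> _ _ <- [i /andP[si ij] ->] /subsetP/(_ j).
  by rewrite !inE ij orbT ltnn orbF => /(_ isT); lia.
Qed.

Lemma seg_sat_ext m m' : (forall i, i \notin upto_s -> m i = m' i) ->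
  seg_sat m -> seg_sat m'.
Proof.
move=> e [w sw wm]; exists w => // i is_.
have [lt|si] := ltnP i s; first by rewrite (segment_below sw).
by rewrite -e ?wm // inE -ltnNge ltn_neqAle eq_sym is_.
Qed.

Lemma prefix_ge_ext_upto k m m' : (forall i, i \notin upto_s -> m i = m' i) ->
  prefix_ge k m -> prefix_ge k m'.
Proof. by move=> e; apply: prefix_ge_ext => i si _; apply: e; rewrite inE -ltnNge. Qed.

(** Here x_s is free, and the vertex contains x_s unless its remaining part is
    already in [slice_hull]. *)
Lemma pretty_sat_block k N :
  (forall m, ~ seg_sat m -> prefix_ge k m -> forall i, (s < i)%N -> (m i < N)%N) ->
  pretty_chain (fun m => seg_sat m /\ slice_hull m) (eq upto_s)
    (fun m => (seg_sat m \/ prefix_ge k m) /\ slice_hull m).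
Proof.
move=> bnd; pose R m := ~ seg_sat m /\ prefix_ge k m.
apply: (@pretty_block _ _ _ _ s R (prefix_ge n.-1) N).
- exact: upset_and upset_seg_sat upset_slice_hull.
- apply: upset_and upset_slice_hull; apply: upset_or upset_seg_sat _.
  exact: upset_prefix_ge.
- by move=> m [Tm Bm]; split=> //; left.
- move=> m; rewrite /R /slice_hull; split=> [[[Tpm Bm] nT]|[[nT pm] Bm]]; last by tauto.
  tauto.
- move=> m m' e [nT pm]; split; last exact: prefix_ge_ext_upto pm.
  by move=> Tm'; apply: nT; apply: seg_sat_ext Tm' => i /e.
- by move=> m m' e; exact: prefix_ge_ext_upto.
- by move=> m _; left; rewrite inE.
- by move=> m [nT pm] _ i; rewrite inE -ltnNge; exact: bnd.
Qed.

(** The variables up to x_s and those strictly between x_j and x_q. *)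
Definition slab_face (q : nat) (j : 'I_n) : {set 'I_n} :=
  [set l : 'I_n | (l <= s)%N || ((j < l)%N && (l < q)%N)].

Section MixedCase.
Variable q : 'I_n.
Hypotheses (us1 : u s = 1%N) (sq : (s < q)%N) (uq : (0 < u q)%N).
Hypothesis u_gap : forall i, (s < i)%N -> (i < q)%N -> u i = 0%N.

(** The generators divisible by x_s lie below [u], which has no variable between
    x_s and x_q: apart from x_s, they live in x_q, ..., x_n. *)
Lemma segment_high_gap w i : segment w -> (0 < w s)%N -> (s < i)%N -> (i < q)%N ->
  w i = 0%N.
Proof.
move=> sw ws; have [_ _ /lexleP h] := sw; have [k ik] := ubnP (i : nat).
elim: k i ik => // k ih i ik si iq; apply/eqP; rewrite -leqn0 -(u_gap si iq).
apply: h => j ji; have [lt|gt|/val_inj ->] := ltngtP j s.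
- by rewrite (segment_below sw) // u0.
- by rewrite ih ?u_gap //; lia.
- by have := segment_first sw; lia.
Qed.

Lemma segment_spike_high i : (q < i)%N -> segment (spike i).
Proof.
move=> qi; have si : (s < i)%N by lia.
split; first exact: mdeg_spike.
- apply/lexleP => l e; have [ls|sl] := leqP l s; first by rewrite v0.
  by have := e _ sl; rewrite v0 // spike_at.
- rewrite lexleE; right; exists q; split=> [|j jq].
    by rewrite spikeE -!val_eqE /= ltn_eqF // gtn_eqF.
  have ji : (i == j) = false by rewrite -val_eqE /=; lia.
  rewrite spikeE ji mul0n addn0; have [lt|gt|/val_inj ->] := ltngtP j s.
  + by rewrite u0 // -val_eqE /= gtn_eqF.
  + by rewrite u_gap // -val_eqE /= ltn_eqF.
  + by rewrite us1 eqxx.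
Qed.

Lemma seg_high_ext m m' : (forall i, (q <= i)%N -> m i = m' i) ->
  seg_high m -> seg_high m'.
Proof.
move=> e [w [sw ws wm]]; exists w; split=> // i is_.
have [lt|si] := ltnP i s; first by rewrite (segment_below sw).
have {}si : (s < i)%N by rewrite ltn_neqAle eq_sym is_.
have [iq|qi] := ltnP i q; first by rewrite (segment_high_gap sw).
by rewrite -e // wm.
Qed.

Lemma high_sat_ext m m' : (forall i, (q < i)%N -> m i = m' i) ->
  high_sat q m -> high_sat q m'.
Proof.
move=> e [w [sw ws wm]]; exists w; split=> // i is_ iq.
have [lt|si] := ltnP i s; first by rewrite (segment_below sw).
have {}si : (s < i)%N by rewrite ltn_neqAle eq_sym is_.
have [lt|qi] := ltnP i q; first by rewrite (segment_high_gap sw).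
by rewrite -e ?wm // ltn_neqAle eq_sym iq.
Qed.

Lemma seg_high_sat m : seg_high m -> high_sat q m.
Proof. by move=> [w [sw ws wm]]; exists w; split=> // i is_ _; exact: wm. Qed.

(** If x_q is the last variable then [u] is x_s times a power of x_q.  This is
    why faces reaching up to x_q arise only when x_q is not the last variable,
    which keeps them from containing it. *)
Lemma high_sat_last m : q = n.-1 :> nat -> high_sat q m.
Proof.
move=> qn; exists u; split=> // [|i is_ iq].
  split=> //; last by apply/lexleE; left.
  by apply/lexleP => l e; have [ls|sl] := leqP l s; [rewrite v0 | have := e _ sl; rewrite v0 //; lia].
have [lt|gt|/val_inj e] := ltngtP i s; first by rewrite u0.
  rewrite u_gap //; move: iq; rewrite -val_eqE /=; have := ltn_ord i; lia.
by rewrite e eqxx in is_.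
Qed.

Lemma seg_high_bound m i : ~ seg_high m -> (q < i)%N -> (m i < d)%N.
Proof.
move=> nF qi; rewrite ltnNge; apply/negP => dm; apply: nF; exists (spike i).
have si : (s < i)%N by lia.
split; [exact: segment_spike_high | by rewrite spike_at |].
by apply: spike_le; lia.
Qed.

Lemma high_sat_bound m i : ~ high_sat q m -> (q < i)%N -> (m i < d)%N.
Proof. by move=> nF; apply: seg_high_bound => /seg_high_sat. Qed.

Lemma seg_high_bound_at m : high_sat q m -> ~ seg_high m -> (m q < d)%N.
Proof.
move=> [w [sw ws wm]] nF; rewrite ltnNge; apply/negP => dm; apply: nF.
exists w; split=> // i is_; have [->|] := eqVneq i q; last exact: wm.
have [dw _ _] := sw; have := mnm_le_mdeg w q; lia.
Qed.

(** After x_q exponents are bounded by the spikes, up to x_q by [prefix_bound]. *)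
Lemma mixed_sat_bound m : ~ seg_sat m -> prefix_ge q m ->
  forall i, (s < i)%N -> (m i < d.+1)%N.
Proof.
move=> nT pm i si; have [qi|iq] := ltnP q i.
  have : (m i < d)%N by apply: seg_high_bound qi => Fm; apply: nT; apply/seg_satE; left.
  by lia.
apply: (prefix_bound pm) si iq => lm; apply: nT; apply/seg_satE; by right.
Qed.

Definition mixed_faces k (Z : {set 'I_n}) := exists2 j : 'I_n, (s < j < k)%N &
  Z = slab_face q j \/ (q < n.-1)%N /\ Z = slab_face q.+1 j.

(** Between the prefix ideals of lengths j+1 and j, keeping only the monomials
    that are also in [F]. *)
Definition mixed_stage (j : 'I_n) (F : 'X_{1..n} -> Prop) m :=
  (seg_sat m \/ prefix_ge j.+1 m \/ (prefix_ge j m /\ F m)) /\ slice_hull m.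

Lemma upset_mixed_stage j F : upset F -> upset (mixed_stage j F).
Proof.
move=> upF; apply: upset_and upset_slice_hull; apply: upset_or upset_seg_sat _.
apply: upset_or (@upset_prefix_ge _) _.
exact: upset_and (@upset_prefix_ge _) upF.
Qed.

(** The new monomials agree with [v] before x_j, are smaller at x_j, and are in
    [F'] but not in [F], a condition on the variables from x_q' on; so those
    strictly between x_j and x_q' are free.  They are not in the saturation of
    the slice, hence all contain x_s. *)
Lemma mixed_block (j : 'I_n) q' (F F' : 'X_{1..n} -> Prop) :
  (s < j < q)%N -> (q <= q')%N -> upset F -> upset F' ->
  (forall m, seg_high m -> F m) -> (forall m, F m -> F' m) ->
  (forall m m', (forall i, (q' <= i)%N -> m i = m' i) -> F m -> F m') ->
  (forall m m', (forall i, (q' <= i)%N -> m i = m' i) -> F' m -> F' m') ->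
  (forall m i, F' m -> ~ F m -> (q' <= i)%N -> (m i < d)%N) ->
  pretty_chain (mixed_stage j F) (eq (slab_face q' j)) (mixed_stage j F').
Proof.
move=> /andP[sj jq] qq' upF upF' highF FF' Fext F'ext bnd.
pose R m := [/\ prefix_ge j m, ~ prefix_ge j.+1 m, F' m & ~ F m].
have jn : (j.+1 <= n.-1)%N by have := ltn_ord q; lia.
have offE i : (i \notin slab_face q' j) = (s < i)%N && ((i <= j)%N || (q' <= i)%N).
  by rewrite inE negb_or -ltnNge negb_and -!leqNgt.
apply: (@pretty_block _ _ _ _ s R (fun=> False) d.+1).
- exact: upset_mixed_stage.
- exact: upset_mixed_stage.
- by move=> m [[Tm|[pm|[pm Fm]]] Bm]; split=> //; [left | right; left | right; right; split; auto].
- move=> m; split=> [[[X' Bm] nX]|[[pj npj F'm nFm] [ms|//]]].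
    have nT : ~ seg_sat m by move=> Tm; apply: nX; split=> //; left.
    have npj : ~ prefix_ge j.+1 m by move=> pm; apply: nX; split=> //; right; left.
    case: X' => [//|[//|[pj F'm]]]; split.
      by split=> // Fm; apply: nX; split=> //; right; right.
    by left; case: Bm => // pm; case: npj; exact: prefix_ge_le pm.
  split; first by split; [right; right | left].
  move=> [[/seg_satE[/highF//|[_ pn]]|[//|[_ //]]] _].
  by apply: npj; apply: prefix_ge_le pn.
- move=> m m' e [pj npj F'm nFm].
  have ext k (p p' : 'X_{1..n}) : (k <= j.+1)%N -> (forall i, i \notin slab_face q' j -> p i = p' i) ->
      prefix_ge k p -> prefix_ge k p'.
    by move=> kj e'; apply: prefix_ge_ext => i si ik; apply: e'; rewrite offE; lia.
  have off_ge i : (q' <= i)%N -> i \notin slab_face q' j by move=> qi; rewrite offE; lia.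
  split.
  + exact: ext e pj.
  + by move=> pm'; apply: npj; apply: ext pm' => // i /e.
  + by apply: F'ext F'm => i /off_ge/e.
  + by move=> Fm'; apply: nFm; apply: Fext Fm' => i /off_ge/e.
- by [].
- by move=> m _; left; rewrite inE leqnn.
- move=> m [pj npj F'm nFm] _ i; rewrite offE => /andP[si /orP[ij|qi]].
    apply: (prefix_bound pj) => // -[_ pn]; apply: npj; exact: prefix_ge_le pn.
  by have := bnd m i F'm nFm qi; lia.
Qed.

(** The step from k = j+1 to j passes through [seg_high] and then through its
    saturation in x_q.  The order of the faces is right: the second face of a
    step contains q, unlike the first, and all faces for a smaller j contain the
    current x_j, which is absent from both. *)
Lemma pretty_mixed k : (k <= q)%N ->
  pretty_chain (fun m => (seg_sat m \/ prefix_ge k m) /\ slice_hull m)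
    (mixed_faces k) slice_hull.
Proof.
have stop k' : (k' <= s.+1)%N -> pretty_chain
    (fun m => (seg_sat m \/ prefix_ge k' m) /\ slice_hull m) (mixed_faces k') slice_hull.
  move=> ks; have -> : (fun m => (seg_sat m \/ prefix_ge k' m) /\ slice_hull m) = slice_hull.
    apply/funext => m; apply/propext; split=> [[]//|Bm]; split=> //; right.
    exact: prefix_ge0.
  exact: pretty_chain_refl.
elim: k => [|k ih] kq; first exact: stop.
have [ks|sk] := leqP k s; first exact: stop.
have kn : (k < n)%N by have := ltn_ord q; lia.
pose j := Ordinal kn; rewrite -[k]/(nat_of_ord j) in kq sk ih *.
have sjq : (s < j < q)%N by rewrite sk.
have stage0 : (fun m => (seg_sat m \/ prefix_ge j.+1 m) /\ slice_hull m) =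
    mixed_stage j seg_high.
  apply/funext => m; apply/propext; rewrite /mixed_stage seg_satE; tauto.
have stage1 : (fun m => (seg_sat m \/ prefix_ge j m) /\ slice_hull m) =
    mixed_stage j total.
  apply/funext => m; apply/propext; rewrite /mixed_stage.
  have := @prefix_ge_le j j.+1 m (leqnSn _); tauto.
have upH : upset seg_high.
  move=> m m' /mnm_lepP mm' [w [sw ws wm]]; exists w; split=> // i /wm h.
  exact: leq_trans h (mm' i).
have step1 : pretty_chain (mixed_stage j seg_high) (eq (slab_face q j))
    (mixed_stage j (high_sat q)).
  apply: mixed_block => //.
  - exact: upset_high_sat.
  - exact: seg_high_sat.
  - exact: seg_high_ext.
  - by move=> m m' e; apply: high_sat_ext => i qi; apply: e; exact: ltnW.
  - move=> m i cm nFm; rewrite leq_eqVlt => /orP[/eqP/val_inj <-|].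
      exact: seg_high_bound_at.
    exact: seg_high_bound.
have step2 : pretty_chain (mixed_stage j (high_sat q))
    (fun Z => (q < n.-1)%N /\ Z = slab_face q.+1 j) (mixed_stage j total).
  have [qn|nq] := ltnP q n.-1.
    have [cs [ch pr dc]] : pretty_chain (mixed_stage j (high_sat q))
        (eq (slab_face q.+1 j)) (mixed_stage j total).
      apply: mixed_block => //.
      - exact: upset_high_sat.
      - exact: seg_high_sat.
      - exact: high_sat_ext.
      - by move=> m i _; exact: high_sat_bound.
    by exists cs; split=> // c /dc.
  have -> : high_sat q = total.
    apply/funext => m; apply/propext; split=> // _; apply: high_sat_last.
    by have := ltn_ord q; lia.
  exact: pretty_chain_refl.
have step : pretty_chain (mixed_stage j seg_high)
    (fun Z => Z = slab_face q j \/ (q < n.-1)%N /\ Z = slab_face q.+1 j) (mixed_stage j total).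
  apply: (pretty_chain_cat step1 step2) => [Z Z' <- [_ ->] /subsetP/(_ q)|Z [<-|]].
  - by rewrite !inE ltnSn ltnn !andbF !orbF; case/andP: sjq => _ ->; rewrite orbT => /(_ isT); lia.
  - by left.
  - by right.
rewrite stage0; apply: (pretty_chain_cat step) (_ : _) _ _.
- by rewrite -stage1; apply: ih; exact: ltnW.
- move=> Z Z' DZ [i /andP[si ij] DZ'] /subsetP/(_ j) sub.
  have jZ' : j \in Z' by case: DZ' => [|[_]] ->; rewrite inE; lia.
  by have := sub jZ'; case: DZ => [|[_]] ->; rewrite inE; lia.
- move=> Z [DZ|[i /andP[si ij] DZ]]; first by exists j => //; rewrite sk ltnSn.
  by exists i => //; rewrite si ltnW.
Qed.

End MixedCase.

Lemma s_lt_last : (s < n.-1)%N.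
Proof.
rewrite ltnNge; apply/negP => ns; have := d_gt0.
rewrite -dv mdegE big1 // => i _; apply: v0; have := ltn_ord i; lia.
Qed.

(** The two cases are whether [seg_sat] contains powers of all variables after
    x_s. *)
Lemma pretty_middle : exists M : {set 'I_n} -> Prop,
  [/\ pretty_chain (fun m => seg_sat m /\ slice_hull m) M slice_hull
    & forall Z, M Z -> s \in Z /\ forall i, i = n.-1 :> nat -> i \notin Z].
Proof.
have sn := s_lt_last.
have upto_ok : s \in upto_s /\ forall i, i = n.-1 :> nat -> i \notin upto_s.
  by rewrite inE leqnn; split=> // i e; rewrite inE e -ltnNge.
have from_bound : (forall m, ~ seg_sat m -> forall i, (s < i)%N -> (m i < d)%N) ->
    exists M : {set 'I_n} -> Prop,
  [/\ pretty_chain (fun m => seg_sat m /\ slice_hull m) M slice_hull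
    & forall Z, M Z -> s \in Z /\ forall i, i = n.-1 :> nat -> i \notin Z].
  move=> bnd; exists (eq upto_s); split=> [|_ <-//].
  have e : (fun m => (seg_sat m \/ prefix_ge 0 m) /\ slice_hull m) = slice_hull.
    apply/funext => m; apply/propext; split=> [[]//|Bm]; split=> //; right.
    exact: prefix_ge0.
  rewrite -[X in pretty_chain _ _ X]e.
  by apply: (@pretty_sat_block 0 d) => m nT _; exact: bnd.
have [us2|us1] := ltnP 1 (u s).
  apply: from_bound => m nT i si; rewrite ltnNge; apply/negP => dm; apply: nT.
  exists (spike i); first exact: segment_spike_mid.
  by apply: spike_le; lia.
have {}us1 : u s = 1%N by lia.
have [[q0 /andP[sq0 uq0]]|nou] := pselect (exists q : 'I_n, (s < q)%N && (0 < u q)%N); last first.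
  apply: from_bound => m nT; case: nT; exists u => [|i is_].
    split=> //; last by apply/lexleE; left.
    apply/lexleP => l e; have [ls|sl] := leqP l s; first by rewrite v0.
    by have := e _ sl; rewrite v0 //; lia.
  have -> // : u i = 0%N; apply/eqP; rewrite -leqn0 leqNgt; apply/negP => ui.
  have [lt|gt|/val_inj e] := ltngtP i s; first by rewrite u0 in ui.
    by apply: nou; exists i; rewrite gt.
  by rewrite e eqxx in is_.
have Pq0 : [pred q : 'I_n | (s < q)%N && (0 < u q)%N] q0 by rewrite /= sq0.
case: (@arg_minnP _ q0 _ (fun i : 'I_n => i : nat) Pq0) => q /andP[sq uq] qmin.
have u_gap i : (s < i)%N -> (i < q)%N -> u i = 0%N.
  move=> si iq; apply/eqP; rewrite -leqn0 leqNgt; apply/negP => ui.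
  by have := qmin i; rewrite /= si ui => /(_ isT); rewrite leqNgt iq.
exists (fun Z => Z = upto_s \/ mixed_faces q q Z); split.
  apply: (@pretty_chain_cat _ _ (eq upto_s) _ (mixed_faces q q) _ _ _ (pretty_mixed us1 sq uq u_gap (leqnn q))).
  - apply: (@pretty_sat_block q d.+1) => m nT pm; exact: (mixed_sat_bound us1 sq uq u_gap).
  - move=> Z Z' <- [j _ DZ'] sub; apply/eqP; rewrite eqEsubset sub /=.
    by case: DZ' => [|[_]] ->; apply/subsetP => l; rewrite !inE => ->.
  - by move=> Z [<-|]; [left | right].
move=> Z [->|[j /andP[sj jq] DZ]] //.
have qn := ltn_ord q.
case: DZ => [|[qlt]] ->; split=> [|i iE]; rewrite inE ?leqnn //; lia.
Qed.

(** The three parts of the chain are told apart by whether their faces contain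
    x_s and the last variable. *)
Lemma pretty_core : pretty_chain seg_ideal (fun=> True) total.
Proof.
have sn := s_lt_last; have [M [chM okM]] := pretty_middle.
have nlast : (n.-1 < n)%N by have := ltn_ord s; lia.
pose last := Ordinal nlast.
apply: (pretty_chain_cat pretty_saturation (D' := fun Z => M Z \/ last \in Z)) => //.
- apply: (pretty_chain_cat chM (pretty_tail_faces (leqnn _))).
  + move=> Z Z' /okM[_ nl] [j /andP[_ jn] ->] /subsetP/(_ last).
    by rewrite (negPf (nl last erefl)) inE /= jn orbT => /(_ isT).
  + move=> Z [|[j /andP[_ jn] ->]]; [by left | right].
    by rewrite inE /= jn orbT.
- move=> Z Z' <- [/okM[sZ' _]|lZ'] /subsetP sub.
    by have := sub _ sZ'; rewrite inE ltnn.
  by have := sub _ lZ'; rewrite inE /=; lia.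
Qed.

End Core.

(** * Arbitrary lexsegments *)

Section Lexsegment.
Variable n : nat.
Implicit Types (u v w m h : 'X_{1..n}).

(** Before s the elements of the segment are squeezed between equal exponents. *)
Lemma segment_common_factor d u v (s : 'I_n) w : segment d u v w ->
  (forall j : 'I_n, (j < s)%N -> v j = u j) ->
  forall i : 'I_n, (i <= s)%N -> (v i <= w i)%N.
Proof.
move=> [_ /lexleP vw /lexleP wu] e.
have eqw k (i : 'I_n) : (i < k)%N -> (i < s)%N -> w i = v i.
  elim: k i => // k ih i ik is_; apply/eqP; rewrite eqn_leq; apply/andP; split.
    by rewrite e //; apply: wu => j ji; rewrite ih ?e //; lia.
  by apply: vw => j ji; rewrite ih //; lia.
move=> i is_; apply: vw => j ji; rewrite (eqw j.+1) //; lia.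
Qed.

Lemma seg_ideal_shift d u v h : mdeg u = d -> (h <= u)%MM -> (h <= v)%MM ->
  (forall w, segment d u v w -> (h <= w)%MM) ->
  seg_ideal d u v = shift h (seg_ideal (d - mdeg h) (u - h)%MM (v - h)%MM).
Proof.
move=> du hu hv hw; apply/funext => m; apply/propext; split.
  move=> [w sw wm]; have hlew := hw w sw; have [dw vw wu] := sw.
  split; first exact: lepm_trans wm.
  exists (w - h)%MM; last first.
    by apply/mnm_lepP => i; rewrite !mnmBE leq_sub2r // (mnm_lepP wm).
  split; first by rewrite -dw -{2}(submK hlew) mdegD addnK.
    by apply/(lexle_add2r h); rewrite !submK.
  by apply/(lexle_add2r h); rewrite !submK.
move=> [hm [w [dw vw wu] wm]].
exists (w + h)%MM; last first.
  apply/mnm_lepP => i; have := mnm_lepP wm i; have := mnm_lepP hm i.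
  by rewrite mnmDE mnmBE; lia.
split.
- by rewrite mdegD dw subnK // -du -(submK hu) mdegD leq_addl.
- by move/(lexle_add2r h) : vw; rewrite submK.
- by move/(lexle_add2r h) : wu; rewrite submK.
Qed.

(** The common factor consists of the exponents of [v] up to the first index at
    which [u] and [v] differ; a principal ideal is a shift of the whole ring. *)
Lemma pretty_lexsegment d u v : mdeg u = d -> mdeg v = d -> lexle v u ->
  pretty_chain (seg_ideal d u v) (fun=> True) (fun _ : 'X_{1..n} => True).
Proof.
move=> du dv /lexleE[vu|[s [vus vu]]].
  have -> : seg_ideal d u v = shift u (fun=> True).
    apply/funext => m; apply/propext; split=> [[w [_ vw wu] wm]|[um _]]; last first.
      by exists u => //; split=> //; rewrite ?vu lexleE; left.
    split=> //; suff -> : u = w by [].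
    have /lexleE[//|uw] : lexle u w by rewrite -vu.
    by move/lexle_lt : wu.
  apply: (@pretty_shift _ _ _ 0%MM) => //; exact: pretty_chain_refl.
pose h : 'X_{1..n} := [multinom if (i <= s)%N then v i else 0%N | i < n].
have hv : (h <= v)%MM by apply/mnm_lepP => i; rewrite mnmE; case: ifP.
have hu : (h <= u)%MM.
  apply/mnm_lepP => i; rewrite mnmE; case: ifP => // is_.
  have [lt|gt|/val_inj ->] := ltngtP i s; [by rewrite vu | lia | exact: ltnW].
rewrite (seg_ideal_shift du hu hv) => [|w sw]; last first.
  apply/mnm_lepP => i; rewrite mnmE; case: ifP => // is_.
  exact: segment_common_factor sw vu i is_.
have du' : mdeg (u - h)%MM = (d - mdeg h)%N by rewrite -du -{2}(submK hu) mdegD addnK.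
have dv' : mdeg (v - h)%MM = (d - mdeg h)%N by rewrite -dv -{2}(submK hv) mdegD addnK.
apply: (@pretty_shift _ _ _ (u - h)%MM); first exact: upset_seg_ideal.
  exists (u - h)%MM; last exact: lepm_refl.
  split=> //; last by rewrite lexleE; left.
  apply/(lexle_add2r h); rewrite !submK //; apply/lexleE; right; by exists s.
apply: (@pretty_core _ _ s) => //.
- by move=> i is_; rewrite mnmBE mnmE is_ subnn.
- by move=> i is_; rewrite mnmBE mnmE ltnW // vu // subnn.
- by rewrite mnmBE mnmE leqnn subn_gt0.
Qed.

End Lexsegment.

Theorem theorem3p5 (K : fieldType) (n d : nat) (u v : 'X_{1..n})
  (hd : (2 <= d)%N) (hu : mdeg u = d) (hv : mdeg v = d) (huv : lexle v u) :
  pretty_clean (mgquot (lexsegment_ideal K d u v)).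
Proof.
have [cs [ch pr _]] := pretty_lexsegment hu hv huv.
apply: (@pretty_clean_cone_chain _ _ _ (seg_ideal d u v) cs _ ch pr) => m; split=> [[w [dw vw wu] wm]|[w wL wm]].
  by exists w => //; rewrite inE dw eqxx wu.
exists w => //; move: wL; rewrite inE => /and3P[/eqP dw wu vw]; by split.
Qed.
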